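(* Given an admissible sequence $w$ and $N\ge2$, the following statements are equivalent. (i) $NA\mathcal{P}(^Nd_*(w,1))$ is dense in $\mathcal{P}(^Nd_*(w,1))$. (ii) If $k\ge N$, every $N$-homogeneous polynomial in $\mathcal{P}(^Nd_*(w,1))$ can be approximated (in the supremum norm) by norm attaining polynomials in $\mathcal{P}_k(d_*(w,1))$. (iii) $w\notin\ell_N$.
   Context: The scalar field $\mathbb{K}$ is $\mathbb{R}$ or $\mathbb{C}$. An admissible sequence is a decreasing (i.e. nonincreasing) sequence $w=(w_i)_{i\in\mathbb{N}}$ of nonnegative reals with $w_1=1$, $\lim_iw_i=0$, $\sum_iw_i=\infty$. Put $W(n)=\sum_{i=1}^nw_i$. $d_*(w,1)$ (the predual of the Lorentz sequence space $d(w,1)$) is the Banach space of all bounded scalar sequences $x=(x(i))_i$ with $\lim_{n\to\infty}\frac{\sum_{i=1}^nx^*(i)}{W(n)}=0$, where $x^*=(x^*(i))_i$ is the decreasing rearrangement of $(|x(i)|)_i$, with norm $\|x\|_W=\sup_n\frac{\sum_{i=1}^nx^*(i)}{W(n)}$. For a Banach space $X$ with closed unit ball $B_X$: $\mathcal{P}(^NX)$ is the Banach space of continuous scalar-valued $N$-homogeneous polynomials on $X$ (maps $x\mapsto\Phi(x,\dots,x)$ with $\Phi$ continuous $N$-linear), and $\mathcal{P}_k(X)$ that of continuous scalar-valued polynomials of degree at most $k$ (sums $\sum_{j=0}^kP_j$ of continuous $j$-homogeneous polynomials), both with norm $\|P\|=\sup_{x\in B_X}|P(x)|$. $P$ is norm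 attaining if $|P(x_0)|=\|P\|$ for some $x_0\in B_X$. $NA\mathcal{P}(^NX)$ is the set of norm attaining elements of $\mathcal{P}(^NX)$. *)

(* Defs.v *)
From HB Require Import structures.
From mathcomp Require Import all_boot all_order all_algebra.
From mathcomp Require Import complex lra.
From mathcomp Require Import all_classical all_reals all_analysis.

Set Implicit Arguments.
Unset Strict Implicit.
Unset Printing Implicit Defensive.

Import Order.TTheory GRing.Theory Num.Theory.
Import numFieldNormedType.Exports.

Local Open Scope classical_set_scope.
Local Open Scope ring_scope.
Local Open Scope card_scope.

Variant scalar_kind := RealScalars | ComplexScalars.

Definition Kfield (R : realType) (F : scalar_kind) : numFieldType :=
  match F with
  | RealScalars => R : numFieldType
  | ComplexScalars => R[i]%C : numFieldType
  end.

(* The norm of a numFieldType takes its values in the field itself; [modulus]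
   is the real-valued absolute value (see [normKE]). *)
Definition modulus (R : realType) (F : scalar_kind) : Kfield R F -> R :=
  match F return Kfield R F -> R with
  | RealScalars => fun x => `|x|
  | ComplexScalars => fun z => ComplexField.Normc.normc z
  end.

Definition ofR (R : realType) (F : scalar_kind) : R -> Kfield R F :=
  match F return R -> Kfield R F with
  | RealScalars => fun r => r
  | ComplexScalars => fun r => r%:C%C
  end.

Section Scalars.
Variables (R : realType) (F : scalar_kind).
Implicit Types x y : Kfield R F.

Lemma normKE x : `|x| = ofR F (modulus x).
Proof. by case: F x => //= -[a b]; rewrite normc_def. Qed.

Lemma le_ofR (r s : R) : (ofR F r <= ofR F s) = (r <= s).
Proof. by case: F => //=; rewrite lecR. Qed.

Lemma ofRD (r s : R) : ofR F (r + s) = ofR F r + ofR F s.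
Proof. by case: F => //=; rewrite rmorphD. Qed.

Lemma ofRM (r s : R) : ofR F (r * s) = ofR F r * ofR F s.
Proof. by case: F => //=; rewrite rmorphM. Qed.

Lemma ofR0 : @ofR R F 0 = 0.
Proof. by case: F => //=. Qed.

Lemma ofR_inj : injective (@ofR R F).
Proof. by move=> r s /eqP; rewrite eq_le !le_ofR -eq_le => /eqP. Qed.

Lemma modulus_ge0 x : 0 <= modulus x.
Proof. by rewrite -le_ofR -normKE ofR0. Qed.

Lemma ler_modulusD x y : modulus (x + y) <= modulus x + modulus y.
Proof. by rewrite -le_ofR ofRD -!normKE ler_normD. Qed.

Lemma modulusM x y : modulus (x * y) = modulus x * modulus y.
Proof. by apply: ofR_inj; rewrite ofRM -!normKE normrM. Qed.

Lemma modulus_eq0 x : modulus x = 0 -> x = 0.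
Proof. by move=> x0; apply/normr0_eq0; rewrite normKE x0 ofR0. Qed.

Lemma modulus0 : modulus (0 : Kfield R F) = 0.
Proof. by apply: ofR_inj; rewrite -normKE normr0 ofR0. Qed.

End Scalars.

(* Sequences indexed by 1, 2, 3, ... are indexed here by 0, 1, 2, ... *)

Definition partial_sum (R : realType) (w : nat -> R) (n : nat) : R :=
  \sum_(i < n) w i.

Record admissible (R : realType) (w : nat -> R) : Prop := Admissible {
  admissible_ge0 : forall i, 0 <= w i ;
  admissible_nonincreasing : {homo w : m n / (m <= n)%N >-> n <= m} ;
  admissible_first : w 0%N = 1 ;
  admissible_cvg0 : w @ \oo --> 0 ;
  admissible_sum : partial_sum w @ \oo --> +oo
}.

(* Decreasing rearrangement through the distribution function: the least
   level t >= 0 that is exceeded by at most n terms. *)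
Definition rearrangement (R : realType) (a : nat -> R) (n : nat) : R :=
  inf [set t | 0 <= t /\ [set i | t < a i] #<= `I_n].

(* The quotient for the first n.+1 terms, so that W (n.+1) > 0. *)
Definition lorentz_quotient (R : realType) (w a : nat -> R) (n : nat) : R :=
  partial_sum (rearrangement a) n.+1 / partial_sum w n.+1.

Section Rearrangement.
Variable R : realType.
Implicit Types a b c w : nat -> R.

Let level a n := [set t : R | 0 <= t /\ [set i | t < a i] #<= `I_n].

Let bounded a := has_ubound (range a).

Lemma has_inf_level a n : bounded a -> has_inf (level a n).
Proof.
move=> [M aM]; split; last by exists 0 => t [].
exists `|M|; split => //; rewrite (_ : [set _ | _] = set0) ?card_ge0//.
apply/seteqP; split => // i /=; rewrite ltNge => /negP; apply.
by rewrite (le_trans _ (ler_norm _))// aM//; exists i.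
Qed.

Lemma rearrangement_ge0 a n : 0 <= rearrangement a n.
Proof.
have [h|/inf_out] := pselect (has_inf (level a n)); last first.
  by rewrite /rearrangement => ->.
by apply: lb_le_inf; [case: h|move=> t []].
Qed.

Lemma card_seq (s : seq nat) : uniq s -> [set` s] #= `I_(size s).
Proof.
elim: s => [_|i s ih /= /andP[si us]].
  have h (A B : set nat) : A = set0 -> B = set0 -> A #= B.
    by move=> -> ->; exact: card_eq00.
  by apply: h; [apply/seteqP; split|exact: II0].
apply/eq_cardSP; exists i; first by rewrite /= mem_head.
rewrite (_ : _ `\ _ = [set` s]); first exact: ih.
apply/seteqP; split => [j [/=]|j /= js].
  by rewrite inE => /orP[/eqP|].
by rewrite inE js orbT; split => // ji; rewrite -ji js in si.
Qed.

Lemma card_leI_size (A : set nat) n (s : seq nat) : uniq s ->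
  (forall i, i \in s -> A i) -> A #<= `I_n -> (size s <= n)%N.
Proof.
move=> us sA An; rewrite -card_le_II.
apply: card_le_trans An; apply: card_le_trans (subset_card_le (A := [set` s]) _).
  by have := card_seq us; rewrite card_eq_le => /andP[].
by move=> i /= /sA.
Qed.

Lemma card_gtI_notin (A : set nat) n (s : seq nat) : uniq s ->
  (size s <= n)%N -> ~ (A #<= `I_n) -> exists2 i, A i & i \notin s.
Proof.
move=> us sn An; apply: contrapT => h; apply: An.
have As : A `<=` [set` s].
  by move=> i Ai /=; apply: contrapT => /negP si; apply: h; exists i.
apply: card_le_trans (subset_card_le As) _.
have := card_seq us; rewrite card_eq_le => /andP[h1 _].
by apply: card_le_trans h1 _; rewrite card_le_II.
Qed.

Lemma rearrangement_gt a n t : (forall i, 0 <= a i) -> bounded a ->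
  t < rearrangement a n -> ~ ([set i | t < a i] #<= `I_n).
Proof.
move=> a0 ba ta; have [t0|t0] := leP 0 t.
  move=> h; move: ta; rewrite ltNge => /negP; apply.
  by apply: ge_inf => //; case: (has_inf_level n ba).
move=> h.
have : (size (iota 0 n.+1) <= n)%N.
  apply: card_leI_size h; first exact: iota_uniq.
  by move=> i _ /=; exact: lt_le_trans (a0 i).
by rewrite size_iota ltnn.
Qed.

Lemma rearrangement_sup a (s : seq nat) : bounded a -> uniq s ->
  \sum_(i <- s) a i <= partial_sum (rearrangement a) (size s).
Proof.
move=> ba; move sn : (size s) => n; elim: n s sn => [|n ih] s sn us.
  by move/size0nil: sn => ->; rewrite big_nil /partial_sum big_ord0.
have [i si imin] : exists2 i, i \in s & {in s, forall j, a i <= a j}.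
  case: s sn us => // k s _ _; elim: s k => [|l s IH] k.
    by exists k => [|j]; rewrite inE // => /eqP ->.
  have [i si imin] := IH l; have [ki|ik] := leP (a k) (a i).
    exists k; first by rewrite mem_head.
    move=> j; rewrite inE => /orP[/eqP -> //|/imin]; exact: le_trans.
  exists i; first by rewrite inE si orbT.
  by move=> j; rewrite inE => /orP[/eqP ->|/imin//]; exact: ltW.
have szr : size (rem i s) = n by rewrite size_rem// sn.
rewrite (big_rem i)//= /partial_sum big_ord_recr/= addrC lerD//.
  by apply: ih => //; exact: rem_uniq.
apply: lb_le_inf; first by case: (has_inf_level n ba).
move=> t [_ tn]; rewrite leNgt; apply/negP => ti.
have : (size s <= n)%N.
  by apply: card_leI_size tn => // j /imin; exact: lt_le_trans.
by rewrite sn ltnn.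
Qed.

Lemma rearrangement_adherent a n e : (forall i, 0 <= a i) -> bounded a ->
  0 < e -> exists s : seq nat, [/\ uniq s, size s = n &
    partial_sum (rearrangement a) n <= \sum_(i <- s) a i + n%:R * e].
Proof.
move=> a0 ba e0; elim: n => [|n [s [us sn sle]]].
  by exists [::]; split=> //; rewrite /partial_sum big_ord0 big_nil mul0r addr0.
have lte : rearrangement a n - e < rearrangement a n.
  by rewrite ltrBlDr ltrDl.
have sn' : (size s <= n)%N by rewrite sn.
have [i /= ai si] := card_gtI_notin us sn' (rearrangement_gt a0 ba lte).
exists (i :: s); split; rewrite /= ?si ?sn//.
rewrite /partial_sum big_ord_recr/= big_cons.
have h : rearrangement a n <= a i + e by rewrite -lerBlDr ltW.
rewrite -natr1; move: sle; rewrite /partial_sum => sle; lra.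
Qed.

Lemma partial_sum_rearrangement_ge0 a n : 0 <= partial_sum (rearrangement a) n.
Proof. by apply: sumr_ge0 => i _; exact: rearrangement_ge0. Qed.

Lemma partial_sum_rearrangementD a b c n :
  (forall i, 0 <= c i) -> bounded a -> bounded b ->
  (forall i, c i <= a i + b i) ->
  partial_sum (rearrangement c) n <=
    partial_sum (rearrangement a) n + partial_sum (rearrangement b) n.
Proof.
move=> c0 ba bb cab.
have bc : bounded c.
  move: ba bb => [M aM] [M' bM']; exists (M + M') => _ [i _ <-].
  by rewrite (le_trans (cab i))// lerD ?aM ?bM'//; exists i.
apply/ler_addgt0Pr => e e0.
have e'0 : 0 < e / n.+1%:R by rewrite divr_gt0.
have [s [us sn sle]] := rearrangement_adherent n c0 bc e'0.
rewrite (le_trans sle)// lerD//; last first.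
  by rewrite mulrA ler_pdivrMr// mulrC ler_wpM2l ?ler_nat// ltW.
rewrite (@le_trans _ _ (\sum_(i <- s) (a i + b i)))//.
  by apply: ler_sum => i _; exact: cab.
by rewrite big_split/= -sn lerD// rearrangement_sup.
Qed.

Lemma partial_sum_rearrangementZ a c k n :
  (forall i, 0 <= c i) -> bounded a -> 0 <= k -> (forall i, c i <= k * a i) ->
  partial_sum (rearrangement c) n <= k * partial_sum (rearrangement a) n.
Proof.
move=> c0 ba k0 cka.
have bc : bounded c.
  move: ba => [M aM]; exists (k * M) => _ [i _ <-].
  by rewrite (le_trans (cka i))// ler_wpM2l// aM//; exists i.
apply/ler_addgt0Pr => e e0.
have e'0 : 0 < e / n.+1%:R by rewrite divr_gt0.
have [s [us sn sle]] := rearrangement_adherent n c0 bc e'0.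
rewrite (le_trans sle)// lerD//; last first.
  by rewrite mulrA ler_pdivrMr// mulrC ler_wpM2l ?ler_nat// ltW.
rewrite (@le_trans _ _ (\sum_(i <- s) (k * a i)))//.
  by apply: ler_sum => i _; exact: cka.
by rewrite -mulr_sumr -sn ler_wpM2l// rearrangement_sup.
Qed.

End Rearrangement.

Section PredualLorentz.
Variables (R : realType) (F : scalar_kind) (w : nat -> R).
Hypothesis hw : admissible w.

Let K := Kfield R F.
Implicit Types x y : nat -> K.

Definition absseq x : nat -> R := fun i => modulus (x i).

Definition predual_lorentz : {pred (nat -> K)} := mem [set x |
  has_ubound (range (absseq x)) /\
  lorentz_quotient w (absseq x) @ \oo --> 0].

Definition lorentz_norm x : R := sup (range (lorentz_quotient w (absseq x))).

Lemma predual_lorentzP x : x \in predual_lorentz <->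
  has_ubound (range (absseq x)) /\ lorentz_quotient w (absseq x) @ \oo --> 0.
Proof. by rewrite inE. Qed.

Let absseq_ge0 x i : 0 <= absseq x i. Proof. exact: modulus_ge0. Qed.

Lemma admissible_partial_sum_gt0 n : 0 < partial_sum w n.+1.
Proof.
rewrite /partial_sum big_ord_recl (admissible_first hw) ltr_pwDl//.
by apply: sumr_ge0 => i _; exact: admissible_ge0.
Qed.

Lemma lorentz_quotient_ge0 a n : 0 <= lorentz_quotient w a n.
Proof.
by rewrite divr_ge0// ?partial_sum_rearrangement_ge0// ltW//
  admissible_partial_sum_gt0.
Qed.

Lemma lorentz_quotientD x y n : x \in predual_lorentz -> y \in predual_lorentz ->
  lorentz_quotient w (absseq (x + y)) n <=
    lorentz_quotient w (absseq x) n + lorentz_quotient w (absseq y) n.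
Proof.
move=> /predual_lorentzP[bx _] /predual_lorentzP[b_y _].
rewrite /lorentz_quotient -mulrDl ler_pM2r ?invr_gt0 ?admissible_partial_sum_gt0//.
by apply: partial_sum_rearrangementD => // i; exact: ler_modulusD.
Qed.

Lemma lorentz_quotientZ_le (k : K) x n : x \in predual_lorentz ->
  lorentz_quotient w (absseq (k *: x)) n <=
    modulus k * lorentz_quotient w (absseq x) n.
Proof.
move=> /predual_lorentzP[bx _].
rewrite /lorentz_quotient mulrA.
rewrite ler_pM2r ?invr_gt0 ?admissible_partial_sum_gt0//.
apply: partial_sum_rearrangementZ => //; first exact: modulus_ge0.
by move=> i; rewrite /absseq -modulusM.
Qed.

Lemma predual_lorentz_ubound x : x \in predual_lorentz ->
  has_ubound (range (lorentz_quotient w (absseq x))).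
Proof.
move=> /predual_lorentzP[_ /cvgP/cvg_seq_bounded[M [_ Mb]]].
exists (M + 1) => _ [n _ <-]; apply: le_trans (ler_norm _) _.
by apply: Mb => //; rewrite ltrDl.
Qed.

Lemma lorentz_quotient_le_norm x n : x \in predual_lorentz ->
  lorentz_quotient w (absseq x) n <= lorentz_norm x.
Proof.
move=> /predual_lorentz_ubound bx; exact: ub_le_sup.
Qed.

Lemma lorentz_norm_le x (c : R) :
  (forall n, lorentz_quotient w (absseq x) n <= c) -> lorentz_norm x <= c.
Proof.
move=> h; apply: ge_sup; first by exists (lorentz_quotient w (absseq x) 0%N), 0%N.
by move=> _ [n _ <-].
Qed.

Lemma predual_lorentz_submod_closed : submod_closed predual_lorentz.
Proof.
have cl0 : (0 : nat -> K) \in predual_lorentz.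
  have a0 : absseq (0 : nat -> K) = (fun=> 0).
    by apply/funext => i; exact: modulus0.
  have b0 : has_ubound (range (absseq (0 : nat -> K))).
    by exists 0 => _ [i _ <-]; rewrite a0.
  apply/predual_lorentzP; split=> //.
  rewrite (_ : lorentz_quotient _ _ = fun=> 0); first exact: cvg_cst.
  apply/funext => n; apply/eqP; rewrite eq_le lorentz_quotient_ge0 andbT.
  rewrite /lorentz_quotient.
  have := @partial_sum_rearrangementZ R _ (absseq (0 : nat -> K)) 0 n.+1
    (@absseq_ge0 0) b0 (lexx 0).
  rewrite mul0r => h.
  rewrite -[leRHS](mul0r (partial_sum w n.+1)^-1).
  rewrite ler_pM2r ?invr_gt0 ?admissible_partial_sum_gt0// h// => i.
  by rewrite a0 mul0r.
split=> // k x y px py; apply/predual_lorentzP.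
have /predual_lorentzP[bx cx] := px.
have /predual_lorentzP[b_y cy] := py.
have pkx : k *: x \in predual_lorentz.
  apply/predual_lorentzP; split.
    case: bx => M xM; exists (modulus k * M) => _ [i _ <-].
    by rewrite /absseq modulusM ler_wpM2l ?modulus_ge0// xM//; exists i.
  apply: (@squeeze_cvgr _ _ _ _ (fun=> 0)
      (fun n => modulus k * lorentz_quotient w (absseq x) n)).
  - by near=> n; rewrite lorentz_quotient_ge0 lorentz_quotientZ_le.
  - exact: cvg_cst.
  - by rewrite -[X in _ --> X](mulr0 (modulus k)); exact: cvgMr.
have /predual_lorentzP[bkx ckx] := pkx.
split.
  case: bkx b_y => M xM [M' yM]; exists (M + M') => _ [i _ <-].
  by apply: le_trans (ler_modulusD _ _) _; rewrite lerD ?xM ?yM//; exists i.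
apply: (@squeeze_cvgr _ _ _ _ (fun=> 0) (fun n =>
    lorentz_quotient w (absseq (k *: x)) n + lorentz_quotient w (absseq y) n)).
- by near=> n; rewrite lorentz_quotient_ge0 lorentz_quotientD.
- exact: cvg_cst.
- by rewrite -[X in _ --> X](addr0 0); exact: cvgD.
Unshelve. all: by end_near. Qed.

HB.instance Definition _ := GRing.isSubmodClosed.Build K (nat -> K)
  predual_lorentz predual_lorentz_submod_closed.

Lemma lorentz_normD x y : x \in predual_lorentz -> y \in predual_lorentz ->
  lorentz_norm (x + y) <= lorentz_norm x + lorentz_norm y.
Proof.
move=> px py; apply: lorentz_norm_le => n.
by apply: le_trans (lorentz_quotientD _ px py) _; rewrite lerD// lorentz_quotient_le_norm.
Qed.

Lemma lorentz_normZ (k : K) x : x \in predual_lorentz ->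
  lorentz_norm (k *: x) = modulus k * lorentz_norm x.
Proof.
move=> px.
have le l z : z \in predual_lorentz ->
    lorentz_norm (l *: z) <= modulus l * lorentz_norm z.
  move=> pz; apply: lorentz_norm_le => n.
  apply: le_trans (lorentz_quotientZ_le _ _ pz) _.
  by rewrite ler_wpM2l ?modulus_ge0// lorentz_quotient_le_norm.
have ge0 z : z \in predual_lorentz -> 0 <= lorentz_norm z.
  move=> /(lorentz_quotient_le_norm 0%N); apply: le_trans.
  exact: lorentz_quotient_ge0.
have pkx : k *: x \in predual_lorentz by exact: rpredZ.
apply/eqP; rewrite eq_le le//=.
have [->|k0] := eqVneq k 0; first by rewrite modulus0 mul0r scale0r ge0// rpred0.
have : modulus k * modulus k^-1 = 1.
  by rewrite -modulusM divff//; apply: (@ofR_inj R F); rewrite -normKE normr1; case: (F).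
move=> kk; have := le k^-1 _ pkx; rewrite scalerA mulVf// scale1r => h.
apply: le_trans (ler_wpM2l (modulus_ge0 k) h) _.
by rewrite mulrA kk mul1r.
Qed.

Lemma lorentz_norm_eq0 x : x \in predual_lorentz -> lorentz_norm x = 0 -> x = 0.
Proof.
move=> px x0; apply/funext => i; apply: modulus_eq0; apply/eqP.
rewrite eq_le modulus_ge0 andbT -x0.
apply: le_trans (lorentz_quotient_le_norm 0%N px).
have /predual_lorentzP[bx _] := px.
have := @rearrangement_sup R (absseq x) [:: i] bx isT.
rewrite big_seq1 /lorentz_quotient => h.
by rewrite [partial_sum w _]big_ord1 (admissible_first hw) divr1.
Qed.

(* The admissibility proof is a parameter of the type so that the norm axioms,
   which rely on it, can be attached to [dstar hw]. *)
Record dstar (adm : admissible w) := Dstar {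
  dstar_seq :> nat -> K ;
  dstar_seqP : dstar_seq \in predual_lorentz }.

HB.instance Definition _ := [isSub of dstar hw for @dstar_seq hw].
HB.instance Definition _ := [Choice of dstar hw by <:].
HB.instance Definition _ := [SubChoice_isSubLmodule of dstar hw by <:].

Lemma dstar_normD (x y : dstar hw) : ofR F (lorentz_norm (x + y)) <=
  ofR F (lorentz_norm x) + ofR F (lorentz_norm y).
Proof. by rewrite -ofRD le_ofR lorentz_normD ?dstar_seqP. Qed.

Lemma dstar_normZ (k : K) (x : dstar hw) :
  ofR F (lorentz_norm (k *: x)) = `|k| * ofR F (lorentz_norm x).
Proof. by rewrite normKE -ofRM lorentz_normZ ?dstar_seqP. Qed.

Lemma dstar_norm_eq0 (x : dstar hw) : ofR F (lorentz_norm x) = 0 -> x = 0.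
Proof.
rewrite -(ofR0 R F) => /ofR_inj /(lorentz_norm_eq0 (dstar_seqP x)) x0.
exact: val_inj.
Qed.

HB.instance Definition _ := Lmodule_isNormed.Build K (dstar hw)
  dstar_normD dstar_normZ dstar_norm_eq0.

End PredualLorentz.

Section Polynomials.
Variables (R : realType) (F : scalar_kind) (V : normedModType (Kfield R F)).
Let K := Kfield R F.
Implicit Types P : V -> K.

Definition multilinear_form (n : nat) (Phi : {ptws 'I_n -> V} -> K) : Prop :=
  forall (v : 'I_n -> V) (i : 'I_n), scalar (fun x : V => Phi (dfwith v i x)).

Definition homogeneous_polynomials (n : nat) : set (V -> K) :=
  [set P | exists Phi : {ptws 'I_n -> V} -> K,
    [/\ multilinear_form Phi, continuous Phi & P = fun x => Phi (fun=> x)]].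

Definition polynomials (k : nat) : set (V -> K) :=
  [set P | exists Q : 'I_k.+1 -> V -> K,
    (forall j : 'I_k.+1, homogeneous_polynomials j (Q j)) /\
    P = fun x => \sum_(j < k.+1) Q j x].

Definition closed_unit_ball : set V := [set x | `|x| <= 1].

Definition poly_norm P : R := sup [set modulus (P x) | x in closed_unit_ball].

Definition norm_attaining : set (V -> K) :=
  [set P | exists2 x0, closed_unit_ball x0 & modulus (P x0) = poly_norm P].

Definition approximable_by (A : set (V -> K)) P : Prop :=
  forall e : R, 0 < e -> exists2 Q, A Q & poly_norm (P - Q) < e.

Definition dense_in (A B : set (V -> K)) : Prop :=
  A `<=` B /\ B `<=` approximable_by A.

End Polynomials.

(* Main.v *)
(* Norms of vectors in d_*(w,1) are controlled by sums over finite index sets,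
   which makes the space close to c_0: a point of the ball can be perturbed far
   out without leaving the ball.

   If w is not in l_N, a signed averaging argument shows that a continuous
   N-linear form is small on blocks that are unit vectors (whose combinations
   with coefficients w_i stay bounded) or flat (with a subsequence whose signed
   sums stay bounded).  Splitting a vector into a head, its large far
   coordinates and a flat rest, every N-homogeneous polynomial is a uniform
   limit of its compositions with coordinate truncations, and these attain
   their norm by compactness.

   If w is in l_N, let M be minimal with w in l_M, and consider
   P(x) = x(1)^(N-M) sum_i x(i)^M.  If Q is close to P and attains its norm at
   x0, then l |-> |Q(x0 + l e_n)| has a local maximum at 0 on a disc independent
   of n.  As n grows, the coefficients of l, ..., l^(M-1) vanish by the first
   part, since w is not in l_j for j < M, while that of l^M stays close to
   x0(1)^(N-M); moving in the right direction then increases |Q|. *)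

(* A form is compared with its truncation by replacing one argument at a time, so mixed tuples
   occur: one argument far out, the others arbitrary. Heads of arbitrary arguments get frozen, and a
   tuple with r arguments still moving only yields the weights w_i^r; since w_i <= 1, divergence for
   N gives divergence for every r <= N.

   In the converse, N itself would not do in place of M: the coefficients of l^j with M <= j < N
   have no reason to vanish. As Q need not be homogeneous, closeness in norm must be turned into
   closeness of homogeneous components, and then of coefficients of powers of l. The precision eps
   has to be chosen before x0 is known; this is possible because |P(x0)| >= 1/2 bounds |x0(1)|^(N-M)
   from below independently of x0.

   Over the reals with M even, no direction changes the sign of the term in l^M, so this sign has to
   agree with that of Q(x0). Here the shape of P matters: sum_i x(i)^M >= 0, so P(x0) has the sign
   of x0(1)^(N-M). *)
Require Import Defs.
From mathcomp Require Import all_boot all_order all_algebra.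
From mathcomp Require Import complex lra ring zify.
From mathcomp Require Import all_classical all_reals all_analysis.

Set Implicit Arguments.
Unset Strict Implicit.
Unset Printing Implicit Defensive.

Import Order.TTheory GRing.Theory Num.Theory.
Import numFieldNormedType.Exports.

Local Open Scope classical_set_scope.
Local Open Scope ring_scope.

(** * Scalars and weights *)

Section ScalarField.
Variables (R : realType) (F : scalar_kind).
Local Notation K := (Kfield R F).
Implicit Types (x y : K) (r : R).

Lemma ofR1 : ofR F 1 = 1 :> K.
Proof. by case: F. Qed.

Lemma modulus_ofR r : modulus (ofR F r) = `|r|.
Proof. by case: F => //=; rewrite expr0n/= addr0 sqrtr_sqr. Qed.

Lemma ge0_modulus_ofR r : 0 <= r -> modulus (ofR F r) = r.
Proof. by move=> r0; rewrite modulus_ofR ger0_norm. Qed.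

Lemma modulus1 : modulus (1 : K) = 1.
Proof. by rewrite -ofR1 modulus_ofR normr1. Qed.

Lemma modulusN x : modulus (- x) = modulus x.
Proof. by apply: (@ofR_inj R F); rewrite -!normKE normrN. Qed.

Lemma modulusB x y : modulus (x - y) = modulus (y - x).
Proof. by rewrite -modulusN opprB. Qed.

Lemma ler_modulusB x y : modulus (x - y) <= modulus x + modulus y.
Proof. by rewrite -(modulusN y) ler_modulusD. Qed.

Lemma ler_dist_modulus x y : `|modulus x - modulus y| <= modulus (x - y).
Proof.
have h (a b : K) : modulus a <= modulus (a - b) + modulus b.
  by rewrite -{1}(subrK b a) ler_modulusD.
rewrite ler_norml; apply/andP; split; last by have := h x y; lra.
by have := h y x; rewrite modulusB; lra.
Qed.

Lemma modulusX x n : modulus (x ^+ n) = modulus x ^+ n.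
Proof. by elim: n => [|n ih]; rewrite ?modulus1// !exprS modulusM ih. Qed.

Lemma modulus_prod (I : Type) (s : seq I) (P : pred I) (f : I -> K) :
  modulus (\prod_(i <- s | P i) f i) = \prod_(i <- s | P i) modulus (f i).
Proof.
by apply: (big_morph _ _ modulus1) => x y; rewrite modulusM.
Qed.

Lemma ler_modulus_sum (I : Type) (s : seq I) (P : pred I) (f : I -> K) :
  modulus (\sum_(i <- s | P i) f i) <= \sum_(i <- s | P i) modulus (f i).
Proof.
elim/big_ind2: _ => [|x a y b xa yb|//]; first by rewrite modulus0.
by apply: le_trans (ler_modulusD _ _) _; rewrite lerD.
Qed.

Lemma ofR_sum (I : Type) (s : seq I) (P : pred I) (f : I -> R) :
  ofR F (\sum_(i <- s | P i) f i) = \sum_(i <- s | P i) ofR F (f i).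
Proof. by apply: (big_morph _ (@ofRD R F)); rewrite ofR0. Qed.

Lemma ofRX r n : ofR F (r ^+ n) = ofR F r ^+ n.
Proof. by elim: n => [|n ih]; rewrite ?ofR1// !exprS ofRM ih. Qed.

Lemma ofRN r : ofR F (- r) = - ofR F r.
Proof. by apply/eqP; rewrite -addr_eq0 -ofRD addNr ofR0. Qed.

Lemma lt_ofR r s : (ofR F r < ofR F s) = (r < s).
Proof. by rewrite !lt_neqAle le_ofR (inj_eq (@ofR_inj R F)). Qed.

Lemma phaseP x : exists2 u : K, modulus u <= 1 & u * x = ofR F (modulus x).
Proof.
have [->|x0] := eqVneq x 0.
  by exists 0; rewrite ?modulus0 ?ler01// mul0r ofR0.
exists (`|x| / x); last by rewrite mulfVK // normKE.
rewrite -(@le_ofR R F) -normKE normrM normr_id normfV divff ?normr_eq0// ofR1//.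
Qed.

Lemma gt0_ofR (e : K) : 0 < e -> exists2 r, 0 < r & ofR F r = e.
Proof.
move=> e0; exists (modulus e); last by rewrite -normKE gtr0_norm.
by rewrite -lt_ofR ofR0 -normKE normr_gt0 gt_eqF.
Qed.

Lemma modulus_gt0 x : x != 0 -> 0 < modulus x.
Proof.
move=> x0; rewrite lt_neqAle modulus_ge0 andbT eq_sym.
by apply: contra_neq x0 => /modulus_eq0.
Qed.

End ScalarField.

Section Weight.
Variables (R : realType) (w : nat -> R) (hw : admissible w).
Local Notation W := (partial_sum w).

Lemma partial_sumS (a : nat -> R) n : partial_sum a n.+1 = partial_sum a n + a n.
Proof. by rewrite /partial_sum big_ord_recr. Qed.

Lemma weight_le1 i : w i <= 1.
Proof. by rewrite -(admissible_first hw); exact: admissible_nonincreasing. Qed.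

Lemma weight_sum_ge0 n : 0 <= W n.
Proof. by apply: sumr_ge0 => i _; exact: admissible_ge0. Qed.

Lemma weight_sum_mono : {homo W : m n / (m <= n)%N >-> m <= n}.
Proof.
apply: homo_leq => [//|x y z|n]; first exact: le_trans.
by rewrite partial_sumS lerDl admissible_ge0.
Qed.

Lemma weight_sum_unbounded (c : R) : exists n, c <= W n.
Proof.
have /cvgryPge/(_ c) [n _ h] := admissible_sum hw.
by exists n; apply: h => /=.
Qed.

Lemma weight_sum1 : W 1 = 1.
Proof. by rewrite /partial_sum big_ord1 (admissible_first hw). Qed.

Lemma weight_sum_ge1 n : (0 < n)%N -> 1 <= W n.
Proof. by move=> n0; rewrite -weight_sum1 weight_sum_mono. Qed.

Lemma weight_sum_le n : W n <= n%:R.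
Proof.
elim: n => [|n ih]; first by rewrite /partial_sum big_ord0.
by rewrite partial_sumS -natr1 lerD// weight_le1.
Qed.

(** A zero weight would, by monotonicity, stop the growth of the partial sums, which diverge. *)
Lemma weight_gt0 i : 0 < w i.
Proof.
rewrite lt_neqAle admissible_ge0// andbT; apply/eqP => wi0.
have [n Wn] := weight_sum_unbounded (W i + 1).
have h m : W (i + m) <= W i.
  elim: m => [|m ih]; rewrite ?addn0// addnS partial_sumS.
  rewrite -[leRHS]addr0 lerD// wi0 (admissible_nonincreasing hw)//.
  exact: leq_addr.
have := le_trans (weight_sum_mono (leq_addl i n)) (h n).
by move=> /(le_trans Wn); lra.
Qed.

Lemma weight_small (e : R) : 0 < e -> exists n, forall m, (n <= m)%N -> w m <= e.
Proof.
move=> e0; have /cvgrPdist_le/(_ _ e0) [n _ h] := admissible_cvg0 hw.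
exists n => m nm; have := h m nm.
by rewrite /= sub0r normrN ger0_norm// admissible_ge0.
Qed.

(** The first terms add at most 1 each, the later ones at most [e] each. *)
Lemma weight_sum_sublinear (e : R) : 0 < e ->
  exists2 c, 0 < c & forall n, W n <= c + e * n%:R.
Proof.
move=> e0; have [n0 hn0] := weight_small e0.
exists (n0%:R + 1) => [|n]; first by rewrite ltr_wpDl.
have h m : W (n0 + m) <= n0%:R + e * m%:R.
  elim: m => [|m ih]; first by rewrite addn0 mulr0 addr0 weight_sum_le.
  rewrite addnS partial_sumS -natr1 mulrDr mulr1 addrA lerD// hn0//.
  exact: leq_addr.
apply: le_trans (weight_sum_mono (leq_addl n0 n)) _.
by apply: le_trans (h n) _; lra.
Qed.

End Weight.

(** * The space d_*(w,1) *)

Section Dstar.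
Variables (R : realType) (F : scalar_kind) (w : nat -> R) (hw : admissible w).
Local Notation K := (Kfield R F).
Local Notation W := (partial_sum w).
Local Notation X := (dstar F hw).
Implicit Types (x y : X) (s : seq nat) (a : nat -> K).

Definition lnorm x : R := lorentz_norm w x.

Lemma normE x : `|x| = ofR F (lnorm x).
Proof. by []. Qed.

Lemma lnorm_ge0 x : 0 <= lnorm x.
Proof. by rewrite -(@le_ofR R F) ofR0 -normE. Qed.

Lemma lnormD x y : lnorm (x + y) <= lnorm x + lnorm y.
Proof. by rewrite -(@le_ofR R F) ofRD -!normE ler_normD. Qed.

Lemma lnormZ (k : K) x : lnorm (k *: x) = modulus k * lnorm x.
Proof. by apply: (@ofR_inj R F); rewrite ofRM -normE -normKE normrZ. Qed.

Lemma lnormN x : lnorm (- x) = lnorm x.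
Proof. by apply: (@ofR_inj R F); rewrite -!normE normrN. Qed.

Lemma lnormB x y : lnorm (x - y) <= lnorm x + lnorm y.
Proof. by rewrite -(lnormN y) lnormD. Qed.

Lemma ler_dist_lnorm x y : `|lnorm x - lnorm y| <= lnorm (x - y).
Proof.
have h (a b : X) : lnorm a <= lnorm (a - b) + lnorm b.
  by rewrite -{1}(subrK b a) lnormD.
rewrite ler_norml; apply/andP; split; last by have := h x y; lra.
by have := h y x; rewrite -(lnormN (y - x)) opprB; lra.
Qed.

Lemma lnorm0 : lnorm 0 = 0.
Proof. by apply: (@ofR_inj R F); rewrite -normE normr0 ofR0. Qed.

Lemma lnorm_sum (I : Type) (r : seq I) (P : pred I) (f : I -> X) :
  lnorm (\sum_(i <- r | P i) f i) <= \sum_(i <- r | P i) lnorm (f i).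
Proof.
elim/big_ind2: _ => [|x c y b xa yb|//]; first by rewrite lnorm0.
by apply: le_trans (lnormD _ _) _; rewrite lerD.
Qed.

Lemma closed_unit_ballE x : closed_unit_ball x <-> lnorm x <= 1.
Proof. by rewrite /closed_unit_ball/= normE -(ofR1 R F) le_ofR. Qed.

Lemma dstarD x y i : (x + y) i = x i + y i.
Proof. by []. Qed.

Lemma dstarB x y i : (x - y) i = x i - y i.
Proof. by []. Qed.

Lemma dstarZ (k : K) x i : (k *: x) i = k * x i.
Proof. by []. Qed.

Lemma dstar_sum (I : Type) (r : seq I) (P : pred I) (f : I -> X) i :
  (\sum_(j <- r | P j) f j) i = \sum_(j <- r | P j) f j i.
Proof. by apply: (big_morph (fun x : X => x i)) => // x y; rewrite dstarD. Qed.

Lemma dstarP x y : (forall i, x i = y i) -> x = y.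
Proof. by move=> xy; apply: val_inj; apply/funext. Qed.

Lemma dstar_bounded x : has_ubound (range (absseq x)).
Proof. by case/predual_lorentzP: (dstar_seqP x). Qed.

(** With the converse [lnorm_le], this makes the norm the best constant in these inequalities, so
    that estimates need not mention the rearrangement. *)
Lemma sum_modulus_le x s : uniq s ->
  \sum_(i <- s) modulus (x i) <= lnorm x * W (size s).
Proof.
move=> us; case: s us => [_|i s us].
  by rewrite big_nil mulr_ge0 ?lnorm_ge0 ?weight_sum_ge0.
rewrite -ler_pdivrMr ?(admissible_partial_sum_gt0 hw)//.
apply: le_trans (lorentz_quotient_le_norm (size s) (dstar_seqP x)).
rewrite ler_pM2r ?invr_gt0 ?(admissible_partial_sum_gt0 hw)//.
exact: rearrangement_sup (dstar_bounded x) us.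
Qed.

(** About a bare sequence, because it also serves to prove membership in the space. *)
Lemma lorentz_quotient_le a (c : R) n : has_ubound (range (absseq a)) ->
  (forall s, uniq s -> size s = n.+1 ->
    \sum_(i <- s) modulus (a i) <= c * W n.+1) ->
  lorentz_quotient w (absseq a) n <= c.
Proof.
move=> ba h; rewrite ler_pdivrMr ?(admissible_partial_sum_gt0 hw)//.
apply/ler_addgt0Pr => e e0.
have e'0 : 0 < e / n.+1%:R by rewrite divr_gt0.
have a0 i : 0 <= absseq a i by exact: modulus_ge0.
have [s [us sn sle]] := rearrangement_adherent n.+1 a0 ba e'0.
rewrite (le_trans sle)// mulrC divfK ?pnatr_eq0// lerD2r.
exact: h.
Qed.

Lemma lnorm_le x (c : R) :
  (forall s, uniq s -> \sum_(i <- s) modulus (x i) <= c * W (size s)) ->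
  lnorm x <= c.
Proof.
move=> h; apply: lorentz_norm_le => n.
apply: lorentz_quotient_le; first exact: dstar_bounded.
by move=> s us sn; rewrite -sn h.
Qed.

Lemma modulus_coord_le x i : modulus (x i) <= lnorm x.
Proof.
have := @sum_modulus_le x [:: i] isT.
by rewrite big_seq1 /= weight_sum1// mulr1.
Qed.

Lemma sum_modulus_small x (e : R) : 0 < e -> exists n, forall s, uniq s ->
  (n <= size s)%N -> \sum_(i <- s) modulus (x i) <= e * W (size s).
Proof.
move=> e0; have /predual_lorentzP[bx cx] := dstar_seqP x.
have /cvgrPdist_le/(_ _ e0) [n _ h] := cx.
exists n.+1 => -[//|i s] us ns; have := h (size s) ns.
rewrite /= sub0r normrN ger0_norm ?lorentz_quotient_ge0// => {}h.
rewrite -ler_pdivrMr ?(admissible_partial_sum_gt0 hw)//.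
apply: le_trans h.
rewrite ler_pM2r ?invr_gt0 ?(admissible_partial_sum_gt0 hw)//.
exact: rearrangement_sup (dstar_bounded x) us.
Qed.

Lemma sum_modulus_supp a L s : uniq s -> (forall i, (L <= i)%N -> a i = 0) ->
  \sum_(i <- s) modulus (a i) = \sum_(i <- [seq i <- s | i < L]%N) modulus (a i).
Proof.
move=> us aL; rewrite big_filter [LHS](bigID (fun i => i < L)%N)/=.
rewrite [X in _ + X]big1 ?addr0// => i; rewrite -leqNgt => /aL ->.
by rewrite modulus0.
Qed.

Lemma size_filter_lt L s : uniq s -> (size [seq i <- s | i < L]%N <= L)%N.
Proof.
move=> us; rewrite -[leqRHS](size_iota 0); apply: uniq_leq_size.
  exact: filter_uniq.
by move=> i; rewrite mem_filter mem_iota add0n => /andP[].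
Qed.

Lemma finite_support_predual a L : (forall i, (L <= i)%N -> a i = 0) ->
  a \in predual_lorentz w.
Proof.
move=> aL; pose T := \sum_(i < L) modulus (a i).
have T0 : 0 <= T by apply: sumr_ge0 => i _; exact: modulus_ge0.
have sT s : uniq s -> \sum_(i <- s) modulus (a i) <= T.
  move=> us; rewrite (sum_modulus_supp us aL) /T.
  rewrite -(big_mkord xpredT (fun i => modulus (a i))) /index_iota subn0.
  rewrite [leRHS](bigID (mem s))/= -[X in _ <= X + _]big_filter.
  rewrite (perm_big [seq i <- iota 0 L | i \in s])/=; last first.
    apply: uniq_perm; rewrite ?filter_uniq ?iota_uniq// => i.
    by rewrite !mem_filter mem_iota andbC.
  by rewrite lerDl sumr_ge0// => i _; exact: modulus_ge0.
have ba : has_ubound (range (absseq a)).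
  exists T => _ [i _ <-]; have := sT [:: i] isT.
  by rewrite big_seq1.
apply/predual_lorentzP; split=> //; apply/cvgrPdist_le => e e0.
have [n Wn] := weight_sum_unbounded hw (T / e).
near=> m; rewrite sub0r normrN ger0_norm ?lorentz_quotient_ge0//.
apply: lorentz_quotient_le => // s us _; apply: le_trans (sT s us) _.
rewrite mulrC -ler_pdivrMr// (le_trans Wn)// weight_sum_mono//.
by rewrite leqW//; near: m; exact: nbhs_infty_ge.
Unshelve. all: by end_near. Qed.

Lemma dtrunc_subproof L a :
  (fun i => if (i < L)%N then a i else 0) \in predual_lorentz w.
Proof.
by apply: (@finite_support_predual _ L) => i; rewrite leqNgt => /negbTE ->.
Qed.

(** Takes an arbitrary sequence, so that it also builds points of the space from finitely many
    prescribed coordinates. *)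
Definition dtrunc L a : X := Dstar hw (dtrunc_subproof L a).

Lemma dtruncE L a i : dtrunc L a i = if (i < L)%N then a i else 0.
Proof. by []. Qed.

Definition dunit j : X := dtrunc j.+1 (fun i => (i == j)%:R).

Lemma dunitE j i : dunit j i = (i == j)%:R.
Proof. by rewrite dtruncE; case: ltngtP => //; case: eqP => //; lia. Qed.

Lemma dtrunc_sum L x : dtrunc L x = \sum_(i < L) x i *: dunit i.
Proof.
apply: dstarP => i; rewrite dtruncE dstar_sum.
case: ltnP => iL.
  rewrite (bigD1 (Ordinal iL))// dstarZ dunitE eqxx mulr1 big1.
    exact/esym/addr0.
  move=> j; rewrite -val_eqE dstarZ dunitE [i == _]eq_sym => /negbTE /= ->.
  by rewrite mulr0.
rewrite big1// => j _; rewrite dstarZ dunitE gtn_eqF ?mulr0//.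
exact: leq_trans (ltn_ord j) iL.
Qed.

Lemma lnorm_mono x y : (forall i, modulus (x i) <= modulus (y i)) ->
  lnorm x <= lnorm y.
Proof.
move=> xy; apply: lnorm_le => s us; apply: le_trans (sum_modulus_le y us).
by apply: ler_sum.
Qed.

Lemma lnorm_dtrunc L x : lnorm (dtrunc L x) <= lnorm x.
Proof.
apply: lnorm_mono => i; rewrite dtruncE; case: ifP => // _.
by rewrite modulus0 modulus_ge0.
Qed.

Lemma lnorm_tail L x : lnorm (x - dtrunc L x) <= lnorm x.
Proof.
apply: lnorm_mono => i; rewrite dstarB dtruncE; case: ifP => _.
  by rewrite subrr modulus0 modulus_ge0.
by rewrite subr0.
Qed.

Lemma dtruncD L x y : dtrunc L (x + y) = dtrunc L x + dtrunc L y.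
Proof.
by apply: dstarP => i; rewrite dstarD !dtruncE; case: ifP; rewrite ?addr0.
Qed.

Lemma dtruncZ L (k : K) x : dtrunc L (k *: x) = k *: dtrunc L x.
Proof.
by apply: dstarP => i; rewrite dstarZ !dtruncE; case: ifP; rewrite ?mulr0.
Qed.

Lemma lnorm_dunit j : lnorm (dunit j) <= 1.
Proof.
apply: lnorm_le => s us; rewrite mul1r.
rewrite (eq_bigr (fun i => if i == j then 1 else 0)); last first.
  by move=> i _; rewrite dunitE; case: eqP => _; rewrite ?modulus1 ?modulus0.
rewrite -big_mkcond/=; have [js|js] := boolP (j \in s); last first.
  by rewrite big_seq_cond big_pred0 ?weight_sum_ge0// => i;
    apply/negP => /andP[is_ /eqP ij]; rewrite -ij is_ in js.
rewrite (big_rem j)//= eqxx big_seq_cond big_pred0 ?addr0.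
  by apply: weight_sum_ge1 => //; case: (s) js.
by move=> i; rewrite rem_filter// mem_filter/=; case: (i == j); rewrite ?andbF.
Qed.

(** Otherwise arbitrarily many coordinates exceed [e], and their sum exceeds [e] times their number,
    hence [e] times [W] of it. *)
Lemma dstar_coord_small x (e : R) : 0 < e ->
  exists n, forall i, (n <= i)%N -> modulus (x i) <= e.
Proof.
move=> e0; have [n h] := sum_modulus_small x e0.
apply: contrapT => /forallNP g.
have {}g m : exists2 i, (m <= i)%N & e < modulus (x i).
  apply: contrapT => g'; apply: (g m) => i mi; rewrite leNgt.
  by apply/negP => ei; apply: g'; exists i.
have [s [us sn se]] : exists s, [/\ uniq s, size s = n.+1 &
    forall i, i \in s -> e < modulus (x i)].
  elim: n.+1 => [|k [s [us sk se]]]; first by exists [::].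
  (* The successor of the sum exceeds every element of [s], so the new index is fresh. *)
  have [i mi ei] := g (\sum_(j <- s) j).+1.
  exists (i :: s); split=> //=; rewrite ?us ?sk ?andbT//.
    apply/negP => si; move: mi; rewrite (big_rem i)//=; lia.
  by move=> j; rewrite inE => /orP[/eqP ->|/se].
have := h s us; rewrite sn leqnSn => /(_ isT).
apply/negP; rewrite -ltNge.
apply: (@le_lt_trans _ _ (e * (size s)%:R)).
  by rewrite ler_pM2l// sn weight_sum_le.
rewrite -sum1_size natr_sum mulr_sumr [ltLHS]big_seq [ltRHS]big_seq.
apply: ltr_sum => [|i si]; last by rewrite mulr1 se.
by case: s sn {us se} => // i s _; apply/hasP; exists i; rewrite mem_head.
Qed.

(** Large index sets are controlled by the limit condition for [x] itself, the sets of fewer than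
    [n] indices by the smallness of the far coordinates. *)
Lemma lnorm_tail_cvg x (e : R) : 0 < e ->
  exists n, forall L, (n <= L)%N -> lnorm (x - dtrunc L x) <= e.
Proof.
move=> e0; have [n h] := sum_modulus_small x e0.
have e'0 : 0 < e / n.+1%:R by rewrite divr_gt0.
have [m xm] := dstar_coord_small x e'0.
exists m => L mL; apply: lnorm_le => s us.
have tl i : modulus ((x - dtrunc L x) i) <= modulus (x i).
  rewrite dstarB dtruncE; case: ifP => _; last by rewrite subr0.
  by rewrite subrr modulus0 modulus_ge0.
have [ns|ns] := leqP n (size s).
  by apply: le_trans (h s us ns); exact: ler_sum.
case: s us ns => [_ _|i s us ns].
  by rewrite big_nil mulr_ge0 ?weight_sum_ge0// ltW.
apply: (@le_trans _ _ e); last by rewrite ler_peMr ?weight_sum_ge1 // ltW.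
apply: (@le_trans _ _ (\sum_(j <- i :: s) e / n.+1%:R)).
  apply: ler_sum => j _; rewrite dstarB dtruncE; case: ltnP => jL.
    by rewrite subrr modulus0 ltW.
  by rewrite subr0 xm// (leq_trans mL).
rewrite big_const_seq count_predT iter_addr_0 -[leLHS]mulr_natr mulrAC.
rewrite ler_pdivrMr// ler_pM2l// ler_nat.
by rewrite ltnW// ltnW.
Qed.

(* This c_0-like property is the obstruction to attaining the norm. *)
Lemma perturb_in_ball x : lnorm x <= 1 -> exists n, exists2 d : R, 0 < d &
  forall j (k : K), (n <= j)%N -> modulus k <= d -> lnorm (x + k *: dunit j) <= 1.
Proof.
move=> x1; have e0 : 0 < 2^-1 :> R by rewrite invr_gt0.
(* Sets of at least [n] indices leave a slack of half of [W]. In a smaller set the index [j] raises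
   the allowance by at least [t = w n], shared equally by [x j] and the perturbation. *)
have [n h] := sum_modulus_small x e0.
have t0 := weight_gt0 hw n; set t := w n in t0.
have t20 : 0 < t / 2 by rewrite divr_gt0.
have [m xm] := dstar_coord_small x t20.
have t1 : t <= 1 by exact: weight_le1.
exists m, (t / 2) => // j k mj kt.
apply: lnorm_le => s us; rewrite mul1r.
have [js|js] := boolP (j \in s); last first.
  rewrite (@le_trans _ _ (\sum_(i <- s) modulus (x i)))//.
    rewrite !big_seq; apply: ler_sum => i si; rewrite dstarD dstarZ dunitE.
    case: eqP => [ij|_]; last by rewrite mulr0 addr0.
    by rewrite -ij si in js.
  apply: le_trans (sum_modulus_le x us) _.
  by rewrite ler_piMl ?weight_sum_ge0.
have le1 : \sum_(i <- s) modulus ((x + k *: dunit j) i) <=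
    \sum_(i <- rem j s) modulus (x i) + modulus (x j) + modulus k.
  rewrite (big_rem j)// dstarD dstarZ dunitE eqxx mulr1 [leLHS]addrC -addrA.
  apply: lerD.
    rewrite !big_seq; apply: ler_sum => i; rewrite rem_filter// mem_filter.
    by case/andP=> /negbTE ij _; rewrite dstarD dstarZ dunitE ij mulr0 addr0.
  exact: ler_modulusD.
have sz : size s = (size (rem j s)).+1.
  by rewrite size_rem// prednK//; case: (s) js.
have [ns|ns] := leqP n (size s).
  have := h s us ns; rewrite (big_rem j)//= => hs.
  have := weight_sum_ge1 hw (n := size s); rewrite {1}sz => /(_ isT) W1.
  have := modulus_ge0 (x j) => xj.
  apply: le_trans le1 _; move: hs kt t1 W1; rewrite -/t; lra.
apply: le_trans le1 _; rewrite -addrA sz partial_sumS lerD//.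
  apply: le_trans (sum_modulus_le x _) _; first by rewrite rem_uniq.
  by rewrite ler_piMl ?weight_sum_ge0.
apply: (@le_trans _ _ t).
  by have := xm j mj; move: kt; lra.
by apply: admissible_nonincreasing => //; rewrite ltnW// -ltnS -sz ltnW.
Qed.

End Dstar.

(** * Multilinear forms *)

Section Update.
Variables (I : eqType) (T : Type).
Implicit Types (v : I -> T) (a b : T).

Lemma dfwithE v i a : dfwith v i a = fun j => if i == j then a else v j.
Proof. by apply/funext => j; case: dfwithP => [|k /negbTE->]; rewrite ?eqxx. Qed.

Lemma dfwith_id v i : dfwith v i (v i) = v.
Proof. by rewrite dfwithE; apply/funext => j; case: eqP => // ->. Qed.

End Update.

Section MultilinearAlgebra.
Variables (R : realType) (F : scalar_kind).
Local Notation K := (Kfield R F).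
Variables (V : normedModType K) (n : nat).
Variables (Phi : {ptws 'I_n -> V} -> K) (hPhi : multilinear_form Phi).
Implicit Types (u v x y : 'I_n -> V).

Lemma mlP v i (k : K) (a b : V) :
  Phi (dfwith v i (k *: a + b)) = k * Phi (dfwith v i a) + Phi (dfwith v i b).
Proof. exact: hPhi. Qed.

Lemma ml0 v i : Phi (dfwith v i 0) = 0.
Proof.
have := mlP v i 1 0 0; rewrite scaler0 addr0 mul1r.
by move/eqP; rewrite -subr_eq subrr eq_sym => /eqP.
Qed.

Lemma mlZ v i (k : K) (a : V) : Phi (dfwith v i (k *: a)) = k * Phi (dfwith v i a).
Proof. by have := mlP v i k a 0; rewrite addr0 ml0 addr0. Qed.

Lemma mlD v i (a b : V) :
  Phi (dfwith v i (a + b)) = Phi (dfwith v i a) + Phi (dfwith v i b).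
Proof. by have := mlP v i 1 a b; rewrite scale1r mul1r. Qed.

Lemma mlB v i (a b : V) :
  Phi (dfwith v i (a - b)) = Phi (dfwith v i a) - Phi (dfwith v i b).
Proof. by rewrite mlD -scaleN1r mlZ mulN1r. Qed.

Lemma ml_sum (I : Type) (r : seq I) (P : pred I) (f : I -> V) v i :
  Phi (dfwith v i (\sum_(j <- r | P j) f j)) =
  \sum_(j <- r | P j) Phi (dfwith v i (f j)).
Proof.
by apply: (big_morph (fun a => Phi (dfwith v i a))); [exact: mlD|exact: ml0].
Qed.

Lemma ml_sumZ (I : Type) (r : seq I) (P : pred I) (c : I -> K) (f : I -> V) v i :
  Phi (dfwith v i (\sum_(j <- r | P j) c j *: f j)) =
  \sum_(j <- r | P j) c j * Phi (dfwith v i (f j)).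
Proof. by rewrite ml_sum; apply: eq_bigr => j _; rewrite mlZ. Qed.

Lemma ml_scale (c : 'I_n -> K) v :
  Phi (fun k => c k *: v k) = (\prod_k c k) * Phi v.
Proof.
suff h (r : seq 'I_n) : uniq r ->
    Phi (fun k => if k \in r then c k *: v k else v k) =
    (\prod_(k <- r) c k) * Phi v.
  rewrite -h ?index_enum_uniq//; congr Phi; apply/funext => k.
  by rewrite mem_index_enum.
elim: r => [_|k r ih /= /andP[kr ur]].
  by rewrite big_nil mul1r.
rewrite big_cons -mulrA -ih//.
pose z j := if j \in r then c j *: v j else v j.
have -> : (fun j => if j \in k :: r then c j *: v j else v j) =
    dfwith z k (c k *: v k).
  rewrite dfwithE /z; apply/funext => j; rewrite inE eq_sym.
  by case: eqP => [->|].
rewrite mlZ; congr (_ * Phi _); rewrite -[RHS](dfwith_id _ k) /z.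
by rewrite (negbTE kr).
Qed.

Lemma ml_expand x y : Phi (fun k => x k + y k) =
  \sum_(S : {set 'I_n}) Phi (fun k => if k \in S then y k else x k).
Proof.
suff h (r : seq 'I_n) : uniq r -> forall x,
    Phi (fun k => if k \in r then x k + y k else x k) =
    \sum_(S : {set 'I_n} | S \subset r) Phi (fun k => if k \in S then y k else x k).
  transitivity (Phi (fun k => if k \in index_enum 'I_n then x k + y k else x k)).
    by congr Phi; apply/funext => k; rewrite mem_index_enum.
  rewrite h ?index_enum_uniq//; apply: eq_bigl => S.
  have -> // : S \subset index_enum 'I_n.
  by apply/fintype.subsetP => k _; rewrite mem_index_enum.
elim: r => [_|k r ih /= /andP[kr ur]] {}x.
  rewrite (big_pred1 finset.set0) => [|S].
    by congr Phi; apply/funext => k; rewrite finset.in_set0.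
  rewrite /= -finset.subset0; apply: eq_subset_r => k.
  by rewrite finset.in_set0.
pose z x k := if k \in r then x k + y k else x k.
have -> : (fun j => if j \in k :: r then x j + y j else x j) =
    dfwith (z x) k (x k + y k).
  rewrite dfwithE /z; apply/funext => j; rewrite inE eq_sym.
  by case: eqP => [->|].
rewrite mlD (_ : dfwith _ k (x k) = z x); last first.
  by rewrite -[RHS](dfwith_id _ k) /z (negbTE kr).
(* Choosing [y k] in slot [k] amounts to changing the base point [x] there; hence the induction is
   over all [x]. *)
rewrite (_ : dfwith _ k (y k) = z (dfwith x k (y k))); last first.
  rewrite dfwithE; apply/funext => j; rewrite /z dfwithE.
  by case: eqP => // <-; rewrite (negbTE kr).
rewrite !ih// addrC [RHS](bigID (fun S : {set 'I_n} => k \in S))/=; congr (_ + _).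
  rewrite [RHS](reindex_onto (fun S => (k |: S)%SET) (fun S => (S :\ k)%SET))/=;
    last first.
    by move=> S /andP[_ kS]; rewrite finset.setD1K.
  apply: eq_big => [S|S _].
    rewrite finset.setU11 andbT; apply/idP/idP => [Sr|/andP[/fintype.subsetP Sr /eqP Sk]].
      apply/andP; split.
        apply/fintype.subsetP => j; rewrite !inE => /orP[->//|jS].
        by rewrite (fintype.subsetP Sr)// orbT.
      rewrite finset.setU1K//; apply: contra kr; exact: (fintype.subsetP Sr).
    apply/fintype.subsetP => j jS; have := Sr j; rewrite !inE jS orbT => /(_ isT).
    by case/orP => // /eqP jk; move: jS; rewrite -Sk jk !inE eqxx.
  congr Phi; apply/funext => j; rewrite !inE dfwithE eq_sym.
  by case: eqP => [->|_] /=; case: ifP.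
apply: eq_bigl => S; apply/idP/idP => [/fintype.subsetP Sr|/andP[/fintype.subsetP Sr kS]].
  apply/andP; split; first by apply/fintype.subsetP => j /Sr; rewrite inE orbC => ->.
  by apply: contra kr => /Sr.
apply/fintype.subsetP => j jS; have := Sr j jS; rewrite inE => /orP[/eqP jk|//].
by rewrite -jk jS in kS.
Qed.

End MultilinearAlgebra.

Section MultilinearNorm.
Variables (R : realType) (F : scalar_kind) (w : nat -> R) (hw : admissible w).
Local Notation K := (Kfield R F).
Local Notation X := (dstar F hw).
Variable n : nat.
Implicit Types (Phi : {ptws 'I_n -> X} -> K) (u v z : 'I_n -> X).

Definition bounded_on_ball Phi (B C : R) : Prop :=
  forall v, (forall k, lnorm (v k) <= B) -> modulus (Phi v) <= C.

(** Rescale [x] to norm [B] and use homogeneity in slot [k]. *)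
Lemma ml_slot_bound Phi (B C : R) : multilinear_form Phi -> 0 < B ->
  bounded_on_ball Phi B C ->
  forall v k x, (forall j, lnorm (v j) <= B) ->
    modulus (Phi (dfwith v k x)) <= C / B * lnorm x.
Proof.
move=> hPhi B0 hC v k x vB.
have [x0|x0] := eqVneq (lnorm x) 0.
  have -> : x = 0 by apply/normr0_eq0; rewrite normE x0 ofR0.
  by rewrite ml0// modulus0 lnorm0 mulr0.
have x0' : 0 < lnorm x by rewrite lt_neqAle eq_sym x0 lnorm_ge0.
pose c := ofR F (B / lnorm x).
have c0 : 0 <= B / lnorm x by rewrite divr_ge0// ltW.
have := hC (dfwith v k (c *: x)%R).
rewrite mlZ// modulusM ge0_modulus_ofR// => h.
rewrite mulrAC ler_pdivlMr// mulrC -ler_pdivrMr// mulrAC h// => j.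
rewrite dfwithE; case: eqP => // _.
by rewrite lnormZ ge0_modulus_ofR// divfK.
Qed.

Lemma bounded_on_ball_scale Phi (B C : R) : multilinear_form Phi -> 0 < B ->
  bounded_on_ball Phi 1 C -> bounded_on_ball Phi B (B ^+ n * C).
Proof.
move=> hPhi B0 hC v vB.
have Bn0 : 0 <= B^-1 by rewrite invr_ge0 ltW.
have := hC (fun k => ofR F (B^-1) *: v k).
rewrite ml_scale// prodr_const card_ord -ofRX modulusM ge0_modulus_ofR; last first.
  by rewrite exprn_ge0.
rewrite exprVn ler_pdivrMl ?exprn_gt0//; apply => k.
by rewrite lnormZ ge0_modulus_ofR// ler_pdivrMl// mulr1.
Qed.

(** Switches from [v] to [u] one slot at a time; the intermediate tuples are the hybrids [z]. *)
Lemma ml_telescope Phi u v (c : 'I_n -> R) : multilinear_form Phi ->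
  (forall z k, (forall j, z j = u j \/ z j = v j) ->
    modulus (Phi (dfwith z k (u k - v k))) <= c k) ->
  modulus (Phi u - Phi v) <= \sum_k c k.
Proof.
move=> hPhi hc.
suff h (r : seq 'I_n) : uniq r ->
    modulus (Phi (fun k => if k \in r then u k else v k) - Phi v) <=
    \sum_(k <- r) c k.
  have := h (index_enum 'I_n); rewrite index_enum_uniq => /(_ isT).
  by congr (modulus (Phi _ - _) <= _); apply/funext => k; rewrite mem_index_enum.
elim: r => [_|k r ih /= /andP[kr ur]].
  by rewrite subrr modulus0 big_nil.
pose z j := if j \in r then u j else v j.
have -> : (fun j => if j \in k :: r then u j else v j) = dfwith z k (u k).
  rewrite dfwithE /z; apply/funext => j; rewrite inE eq_sym.
  by case: eqP => [->|].
rewrite big_cons.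
rewrite -(subrKA (Phi z)) (le_trans (ler_modulusD _ _))// lerD ?ih//.
rewrite -{2}(dfwith_id z k) -mlB// {2}/z (negbTE kr) hc// => j.
by rewrite /z; case: ifP => _; [left|right].
Qed.

Lemma ml_lipschitz Phi (B C : R) u v : multilinear_form Phi -> 0 < B ->
  bounded_on_ball Phi B C ->
  (forall k, lnorm (u k) <= B) -> (forall k, lnorm (v k) <= B) ->
  modulus (Phi u - Phi v) <= C / B * \sum_k lnorm (u k - v k).
Proof.
move=> hPhi B0 hC uB vB; rewrite mulr_sumr; apply: ml_telescope => // z k zuv.
by apply: ml_slot_bound => // j; case: (zuv j) => ->.
Qed.

Let box (v : 'I_n -> X) (d : R) : set {ptws 'I_n -> X} :=
  [set u | forall k, lnorm (u k - v k) < d].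

(** The filter generated by the boxes around [v] converges to [v] in each of the finitely many
    slots, hence in the product topology. *)
Lemma ptws_box Phi v : {for v, continuous Phi} ->
  exists2 d : R, 0 < d & forall u, box v d u -> modulus (Phi u - Phi v) <= 1.
Proof.
move=> cPhi.
pose G : set_system {ptws 'I_n -> X} := filter_from [set d | 0 < d] (box v).
have GF : Filter G.
  apply: filter_from_filter; first by exists 1; rewrite /= ltr01.
  move=> d e d0 e0; exists (Num.min d e); first by rewrite /= lt_min d0 e0.
  by move=> u uv; split => k; have := uv k; rewrite lt_min => /andP[].
have Gv : G --> (v : {ptws 'I_n -> X}).
  apply/cvg_sup => k A; rewrite /= => -[U [[U' oU' <-] U'v] UA].
  have /nbhs_ballP[e /= e0 eU] : nbhs (v k) U' by apply: open_nbhs_nbhs.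
  have [r r0 re] := gt0_ofR e0.
  exists r => // u uv; apply: UA; apply: eU.
  rewrite -ball_normE /= -re -opprB normrN normE lt_ofR; exact: uv.
have /cvgrPdist_le /(_ 1 ltr01) := cvg_trans (cvg_app Phi Gv) cPhi.
move=> [d /= d0 h]; exists d => // u uv.
by have := h u uv; rewrite /= distrC normKE -(ofR1 R F) le_ofR.
Qed.

Lemma multilinear_bounded Phi : multilinear_form Phi -> continuous Phi ->
  exists2 C : R, 0 < C & bounded_on_ball Phi 1 C.
Proof.
move=> hPhi /(_ (fun=> 0)) /ptws_box[d d0 hd].
pose C0 := 1 + modulus (Phi (fun=> 0)).
have C0gt0 : 0 < C0 by rewrite ltr_pwDl// modulus_ge0.
have d20 : 0 < d / 2 by rewrite divr_gt0.
exists ((d / 2)^-1 ^+ n * C0) => [|v v1].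
  by rewrite mulr_gt0 ?exprn_gt0 ?invr_gt0.
have h u : (forall k, lnorm (u k) <= d / 2) -> modulus (Phi u) <= C0.
  move=> ud; rewrite -(subrK (Phi (fun=> 0)) (Phi u)).
  apply: le_trans (ler_modulusD _ _) _; rewrite lerD2r hd// => k.
  by rewrite subr0 (le_lt_trans (ud k))//; lra.
have := h (fun k => ofR F (d / 2) *: v k).
rewrite ml_scale// prodr_const card_ord -ofRX modulusM ge0_modulus_ofR; last first.
  by rewrite exprn_ge0 ?ltW.
rewrite exprVn ler_pdivlMl ?exprn_gt0//; apply => k.
by rewrite lnormZ (ge0_modulus_ofR _ (ltW d20)) ler_piMr// ltW.
Qed.

Lemma bounded_continuous Phi (C : R) : multilinear_form Phi ->
  bounded_on_ball Phi 1 C -> continuous Phi.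
Proof.
move=> hPhi hC v.
have FF : Filter (nbhs (v : {ptws 'I_n -> X})) by exact: nbhs_filter.
apply: (@cvgrPdist_le K K _ (nbhs (v : {ptws 'I_n -> X})) FF Phi (Phi v)).2 => e e0.
have [r r0 re] := gt0_ofR e0.
(* [B] bounds all points within distance 1 of the entries of [v]. *)
pose B := 1 + \sum_k lnorm (v k) + 1.
have s0 : 0 <= \sum_k lnorm (v k) by apply: sumr_ge0 => k _; exact: lnorm_ge0.
have B1 : 1 <= B by rewrite /B; lra.
have B0 : 0 < B by rewrite (lt_le_trans _ B1).
have hB := bounded_on_ball_scale hPhi B0 hC.
set C' := _ * C in hB.
have vB k : lnorm (v k) + 1 <= B.
  rewrite /B lerD2r (bigD1 k)//= addrCA lerDl addr_ge0// sumr_ge0// => j _.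
  exact: lnorm_ge0.
have C'0 : 0 <= C'.
  apply: le_trans (modulus_ge0 _) (hB (fun=> 0) _) => k.
  by rewrite lnorm0 ltW.
pose d := Num.min 1 (r / (C' / B * n%:R + 1)).
have q0 : 0 < C' / B * n%:R + 1.
  by rewrite ltr_wpDl// mulr_ge0// divr_ge0// ltW.
have d0 : 0 < d by rewrite lt_min ltr01 divr_gt0.
have : \forall u \near (v : {ptws 'I_n -> X}), forall k : 'I_n,
    lnorm (v k - u k) < d.
  apply: (@filter_forall _ _ (fun k (u : {ptws 'I_n -> X}) =>
    lnorm (v k - u k) < d) _ FF) => k.
  have := @proj_continuous _ (fun=> X) k v.
  move=> /cvgrPdist_lt/(_ (ofR F d)); rewrite -(ofR0 R F) lt_ofR => /(_ d0).
  by apply: filterS => u; rewrite normE lt_ofR.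
apply: filterS => u uv.
rewrite normKE -re le_ofR.
have uB k : lnorm (u k) <= B.
  apply: le_trans (vB k).
  rewrite -[u k](subKr (v k)) (le_trans (lnormB _ _))// lerD2l.
  by rewrite (le_trans (ltW (uv k)))// ge_min lexx.
have vB' k : lnorm (v k) <= B by apply: le_trans (vB k); rewrite lerDl.
apply: le_trans (ml_lipschitz hPhi B0 hB vB' uB) _.
apply: (@le_trans _ _ (C' / B * (n%:R * d))).
  rewrite ler_wpM2l ?divr_ge0 ?(ltW B0)//.
  rewrite -[n in n%:R](card_ord n) mulr_natl -sumr_const ler_sum// => k _.
  exact: ltW.
rewrite mulrA; apply: (@le_trans _ _ ((C' / B * n%:R + 1) * d)).
  by rewrite ler_wpM2r ?lerDl// ltW.
by rewrite -ler_pdivlMl// mulrC ge_min lexx orbT.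
Qed.

End MultilinearNorm.

(** * Diagonal sums *)

Section Diagonal.
Variables (R : realType) (F : scalar_kind).
Local Notation K := (Kfield R F).

Lemma modulus_parallel (a b : K) :
  modulus a <= modulus (a + b) \/ modulus a <= modulus (a - b).
Proof.
have [h|h] := leP (modulus a) (modulus (a + b)); [by left|right].
have := ler_modulusD (a + b) (a - b).
rewrite addrACA subrr addr0 -mulr2n -[a *+ 2]mulr_natl modulusM.
have -> : (2%:R : K) = ofR F 2 by rewrite -[2]/(1 + 1) ofRD ofR1.
by rewrite ge0_modulus_ofR//; lra.
Qed.

(* The average over all signs is the diagonal sum, so some choice does at least
   as well; the offset [z] makes the induction go through. *)
Lemma sign_diagonal (m : nat) (B : nat -> nat -> K) (z : K) :
  exists e : nat -> K, (forall i, modulus (e i) = 1) /\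
    modulus (z + \sum_(i < m) B i i) <=
    modulus (z + \sum_(a < m) \sum_(b < m) e a * e b * B a b).
Proof.
elim: m z => [|m ih] z.
  by exists (fun=> 1); split=> [i|]; rewrite ?modulus1// !big_ord0.
have [e [e1 he]] := ih (z + B m m).
pose D := z + B m m + \sum_(a < m) \sum_(b < m) e a * e b * B a b.
pose c := \sum_(a < m) e a * (B a m + B m a).
(* The new sign [s] is chosen so that the cross terms [s * c] do not lower the modulus; [s * s = 1]
   preserves the diagonal entry [B m m]. *)
have [s s1 [ss hs]] : exists2 s : K, modulus s = 1 &
    s * s = 1 /\ modulus D <= modulus (D + s * c).
  have [h|h] := modulus_parallel D c.
    by exists 1; rewrite ?modulus1// !mul1r.
  exists (-1); first by rewrite modulusN modulus1.
  by rewrite mulrNN mulN1r mulr1.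
exists (fun i => if (i < m)%N then e i else s).
split; first by move=> i; case: ifP.
rewrite big_ord_recr/= [_ + B m m]addrC addrA.
apply: le_trans he _; apply: le_trans hs _.
suff -> : D + s * c = z + \sum_(a < m.+1) \sum_(b < m.+1)
  (if (a < m)%N then e a else s) * (if (b < m)%N then e b else s) * B a b by [].
rewrite big_ord_recr/= ltnn.
under eq_bigr => a _.
  rewrite big_ord_recr/= ltnn ltn_ord.
  under eq_bigr => b _ do rewrite ltn_ord.
  over.
rewrite big_split/= [\sum_(b < m.+1) _]big_ord_recr/= ltnn ss mul1r.
under [\sum_(b < m) s * _ * _]eq_bigr => b _ do rewrite ltn_ord.
rewrite /D /c mulr_sumr.
have -> : \sum_(a < m) s * (e a * (B a m + B m a)) =
    \sum_(a < m) e a * s * B a m + \sum_(a < m) s * e a * B m a.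
  by rewrite -big_split; apply: eq_bigr => a _ /=; ring.
ring.
Qed.

End Diagonal.

Section DiagonalForm.
Variables (R : realType) (F : scalar_kind) (w : nat -> R) (hw : admissible w).
Local Notation K := (Kfield R F).
Local Notation X := (dstar F hw).
Variables (d : nat) (Phi : {ptws 'I_d -> X} -> K) (C C1 : R).
Hypotheses (hPhi : multilinear_form Phi) (hC : bounded_on_ball Phi C C1).
Implicit Types (live : {set 'I_d}) (U : 'I_d -> nat -> X) (v : 'I_d -> X).

(** A finite form of weak unconditional convergence. Coefficients range over the whole unit disc, so
    that signs and phases can be absorbed into the blocks. *)
Definition sums_bounded (m : nat) (u : nat -> X) (B : R) : Prop :=
  forall c : nat -> K, (forall i, modulus (c i) <= 1) ->
    lnorm (\sum_(i < m) c i *: u i) <= B.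

Lemma sums_bounded_rotate m u B (e : nat -> K) : (forall i, modulus (e i) <= 1) ->
  sums_bounded m u B -> sums_bounded m (fun i => e i *: u i) B.
Proof.
move=> e1 h c c1; under eq_bigr do rewrite scalerA.
by apply: (h (fun i => c i * e i)) => i; rewrite modulusM mulr_ile1 ?modulus_ge0.
Qed.

(** Induction on the number of live slots. [sign_diagonal], applied to two live slots [k] and [k'],
    turns the diagonal sum into a double sum; summing over slot [k] gives the bounded vector [V],
    which is frozen there, while the signs of the other index move into slot [k']. A single live
    slot is summed by linearity. *)
Lemma diagonal_sum_le m p live U v : #|live| = p.+1 ->
  (forall k, k \in live -> sums_bounded m (U k) C) ->
  (forall k, k \notin live -> lnorm (v k) <= C) ->
  modulus (\sum_(i < m) Phi (fun k => if k \in live then U k i else v k)) <= C1.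
Proof.
elim: p live U v => [|p ih] live U v card_live hU hv.
  have /eqP/cards1P[k lk] := card_live.
  have -> : \sum_(i < m) Phi (fun j => if j \in live then U j i else v j) =
      Phi (dfwith v k (\sum_(i < m) U k i)).
    rewrite ml_sum//; apply: eq_bigr => i _; congr Phi.
    rewrite dfwithE lk; apply/funext => j; rewrite finset.in_set1 eq_sym.
    by case: eqP => // ->.
  apply: hC => j; rewrite dfwithE; case: eqP => [kj|/eqP kj]; last first.
    by apply: hv; rewrite lk finset.in_set1 eq_sym.
  have /hU/(_ (fun=> 1)) : k \in live by rewrite lk finset.in_set1.
  rewrite modulus1 => /(_ (fun=> lexx 1)).
  by under eq_bigr do rewrite scale1r.
have [k kl] : exists k, k \in live by apply/card_gt0P; rewrite card_live.
have card' : #|(live :\ k)%SET| = p.+1.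
  by have := cardsD1 k live; rewrite card_live kl; lia.
have [k' kl'] : exists k', k' \in (live :\ k)%SET.
  by apply/card_gt0P; rewrite card'.
have kk' : k != k' by move: kl'; rewrite finset.in_setD1 eq_sym => /andP[].
pose pat i j := if j \in live then U j i else v j.
have [e [e1]] := sign_diagonal m (fun a b => Phi (dfwith (pat b) k (U k a))) 0.
rewrite !add0r.
have -> : \sum_(i < m) Phi (dfwith (pat i) k (U k i)) = \sum_(i < m) Phi (pat i).
  apply: eq_bigr => i _; congr Phi; rewrite -[RHS](dfwith_id _ k).
  by rewrite {3}/pat kl.
move=> /le_trans; apply.
pose V := \sum_(a < m) e a *: U k a.
pose U' j i := if j == k' then e i *: U j i else U j i.
have e1' i : modulus (e i) <= 1 by rewrite e1.
have -> : \sum_(a < m) \sum_(b < m) e a * e b * Phi (dfwith (pat b) k (U k a)) =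
    \sum_(b < m) Phi (fun j => if j \in (live :\ k)%SET then U' j b
                               else dfwith v k V j).
  rewrite exchange_big/=; apply: eq_bigr => b _.
  transitivity (e b * Phi (dfwith (pat b) k V)).
    rewrite ml_sumZ// mulr_sumr; apply: eq_bigr => a _.
    by rewrite mulrA [e b * _]mulrC.
  rewrite -[dfwith (pat b) k V](dfwith_id _ k') -mlZ//; congr Phi.
  rewrite !dfwithE; apply/funext => j; rewrite finset.in_setD1 /U' [j == k']eq_sym.
  rewrite [j == k]eq_sym (negbTE kk') /pat.
  case: (eqVneq k' j) => [<-|k'j].
    by rewrite (negbTE kk') /=; move: kl'; rewrite finset.in_setD1 => /andP[_ ->].
  by case: (eqVneq k j) => [<-|kj].
apply: ih => // [j|j].
  rewrite finset.in_setD1 => /andP[_ /hU hj]; rewrite /U'.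
  case: eqP => // _; exact: sums_bounded_rotate.
rewrite finset.in_setD1 negb_and negbK dfwithE eq_sym.
by case: eqP => [_ _|_ /= /hv//]; apply: hU.
Qed.

(** The phase of each term is absorbed into one live slot. *)
Lemma diagonal_sum_modulus_le m live U v : (0 < #|live|)%N ->
  (forall k, k \in live -> sums_bounded m (U k) C) ->
  (forall k, k \notin live -> lnorm (v k) <= C) ->
  \sum_(i < m) modulus (Phi (fun k => if k \in live then U k i else v k)) <= C1.
Proof.
move=> l0 hU hv; pose pat i j := if j \in live then U j i else v j.
have /choice[e he] : forall i, exists e : K, modulus e <= 1 /\
    e * Phi (pat i) = ofR F (modulus (Phi (pat i))).
  by move=> i; have [e] := phaseP (Phi (pat i)); exists e.
have /card_gt0P[k kl] := l0.
pose U' j i := if j == k then e i *: U j i else U j i.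
have eqP_ i : ofR F (modulus (Phi (pat i))) =
    Phi (fun j => if j \in live then U' j i else v j).
  have [_ <-] := he i; rewrite -{1}(dfwith_id (pat i) k) -mlZ//; congr Phi.
  rewrite dfwithE; apply/funext => j; rewrite /pat /U' [j == k]eq_sym.
  by case: eqP => // <-; rewrite kl.
rewrite -[leLHS](@ge0_modulus_ofR R F); last first.
  by apply: sumr_ge0 => i _; exact: modulus_ge0.
rewrite ofR_sum; under eq_bigr do rewrite eqP_.
apply: (@diagonal_sum_le _ #|live|.-1) => //; first by rewrite prednK.
move=> j jl; rewrite /U'; case: eqP => _; last exact: hU.
by apply: sums_bounded_rotate; [move=> i; case: (he i)|exact: hU].
Qed.

End DiagonalForm.

(** * Blocks with bounded sums: weighted unit vectors and flat vectors *)

Section BlockSums.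
Variables (R : realType) (F : scalar_kind) (w : nat -> R) (hw : admissible w).
Local Notation K := (Kfield R F).
Local Notation W := (partial_sum w).
Local Notation X := (dstar F hw).

(** The largest index in [s] is at least [size s - 1], so its weight is at most the last term of
    [W (size s)]; remove it and induct. *)
Lemma weight_sum_seq (s : seq nat) : uniq s -> \sum_(i <- s) w i <= W (size s).
Proof.
move: {2}(size s) (erefl (size s)) => n; elim: n s => [|n ih] s sn us.
  by rewrite sn (size0nil sn) big_nil /partial_sum big_ord0.
have [M Ms Mmax] : exists2 M, M \in s & forall i, i \in s -> (i <= M)%N.
  case: s sn us => // k s _ _; elim: s k => [|l s IH] k.
    by exists k => [|i]; rewrite ?mem_head// inE => /eqP ->.
  have [M Ms Mmax] := IH l; have [kM|Mk] := leqP k M.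
    exists M; first by rewrite inE Ms orbT.
    by move=> i; rewrite inE => /orP[/eqP ->|/Mmax].
  exists k; first exact: mem_head.
  move=> i; rewrite inE => /orP[/eqP ->//|/Mmax]; lia.
have szr : size (rem M s) = n by rewrite size_rem// sn.
rewrite (big_rem M)//= sn partial_sumS addrC lerD//.
  by rewrite -szr ih ?rem_uniq.
apply: admissible_nonincreasing => //; rewrite -ltnS -sn -(size_iota 0 M.+1).
apply: uniq_leq_size => // i /Mmax; rewrite mem_iota; lia.
Qed.

Lemma sum_units_le (j : nat -> nat) (m : nat) (c : nat -> K) :
  injective j -> (forall i, modulus (c i) <= w i) ->
  lnorm (\sum_(i < m) c i *: (dunit F hw (j i))) <= 1.
Proof.
move=> jinj cw; apply: lnorm_le => s us; rewrite mul1r.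
apply: (@le_trans _ _ (\sum_(l <- s) \sum_(i < m) if j i == l then w i else 0)).
  apply: ler_sum => l _; rewrite dstar_sum (le_trans (ler_modulus_sum _ _ _))//.
  apply: ler_sum => i _; rewrite dstarZ dunitE eq_sym modulusM.
  by case: eqP => _; rewrite ?modulus1 ?modulus0 ?mulr1 ?mulr0.
rewrite exchange_big/=.
apply: (@le_trans _ _ (\sum_(i < m | j i \in s) w i)).
  rewrite [leRHS]big_mkcond/=; apply: ler_sum => i _.
  case: ifP => [js|/negbT js]; last first.
    rewrite big_seq big1// => l ls; case: eqP => // jl.
    by rewrite jl ls in js.
  rewrite (big_rem (j i))//= eqxx big_seq big1 ?addr0// => l.
  by rewrite rem_filter// mem_filter/= eq_sym => /andP[/negbTE ->].
rewrite -(big_mkord (fun i => j i \in s) w) -big_filter.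
set t := [seq i <- _ | _].
have ut : uniq t by rewrite filter_uniq// iota_uniq.
apply: le_trans (weight_sum_seq ut) _; apply: weight_sum_mono => //.
rewrite -(size_map j); apply: uniq_leq_size; first by rewrite map_inj_uniq.
by move=> _ /mapP[i + ->]; rewrite mem_filter => /andP[].
Qed.

Section Fast.
Variable N : nat -> nat.
Hypotheses (N0 : (0 < N 0)%N) (N2 : forall i, (2 * N i <= N i.+1)%N)
  (NW : forall i, 2 * W (N i) <= W (N i.+1)).

Lemma fast_gt0 i : (0 < N i)%N.
Proof. by elim: i => // i ih; have := N2 i; lia. Qed.

Lemma fast_inv_half i : (N i.+1)%:R^-1 <= (N i)%:R^-1 / 2 :> R.
Proof.
have Ni : 0 < (N i)%:R :> R by rewrite ltr0n fast_gt0.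
have Ni' : 0 < (N i.+1)%:R :> R by rewrite ltr0n fast_gt0.
rewrite -invfM ler_pV2 ?inE ?unitfE ?gt_eqF ?mulr_gt0//.
by rewrite mulrC -natrM ler_nat N2.
Qed.

(* Terms with [N i.+1 <= p] add up geometrically to at most [2 W p], the terms
   far beyond [p] add up geometrically to at most [2], one term is in between. *)
Lemma fast_sum_le (p m : nat) (t : nat -> R) : (0 < p)%N ->
  (forall i, t i <= W p) -> (forall i, t i <= W (N i.+1)) ->
  (forall i, t i <= p%:R / (N i)%:R) -> \sum_(i < m) t i <= 5 * W p.
Proof.
move=> p0 t1 t2 t3; have Wp1 := weight_sum_ge1 hw p0.
have p0' : 0 < p%:R :> R by rewrite ltr0n.
(* In units of [W p] the constant is 2 + 1 + 2: terms before, between and beyond. The subtracted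
   quantity is the reserve for the terms still to come. *)
suff : \sum_(i < m) t i <=
    if (N m <= p)%N then 2 * W (N m) else 5 * W p - 2 * (p%:R / (N m)%:R).
  move=> /le_trans; apply; case: ifP => [Np|_].
    have := weight_sum_mono hw Np; have := weight_sum_ge0 hw p; lra.
  have : 0 <= p%:R / (N m)%:R :> R by rewrite divr_ge0.
  lra.
elim: m => [|m ih]; first rewrite big_ord0.
  case: ifP => [_|/negbT]; first by rewrite mulr_ge0 ?weight_sum_ge0.
  rewrite -ltnNge => pN; have : p%:R / (N 0)%:R <= 1 :> R.
    by rewrite ler_pdivrMr ?ltr0n// mul1r ler_nat ltnW.
  lra.
rewrite big_ord_recr/=; move: ih; have [Nmp ih|Nmp ih] := leqP (N m) p.
  have [Nmp'|Nmp'] := leqP (N m.+1) p; first by have := t2 m; have := NW m; lra.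
  have : p%:R / (N m.+1)%:R <= 1 :> R.
    by rewrite ler_pdivrMr ?ltr0n ?fast_gt0// mul1r ler_nat ltnW.
  have := weight_sum_mono hw Nmp; have := t1 m; lra.
have [Nmp'|_] := leqP (N m.+1) p.
  by have := N2 m; have := fast_gt0 m; lia.
have : p%:R / (N m.+1)%:R <= p%:R / (N m)%:R / 2 :> R.
  by rewrite -mulrA ler_pM2l// fast_inv_half.
have := t3 m; lra.
Qed.

(** From the block [u i], a set of [p] indices collects at most [W p] by the norm, [W (N i.+1)] by
    the support and [p / N i] by flatness, the three bounds of [fast_sum_le]. *)
Lemma sum_flat_le (u : nat -> X) (m : nat) (c : nat -> K) :
  (forall i, lnorm (u i) <= 1) ->
  (forall i l, (N i.+1 <= l)%N -> u i l = 0) ->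
  (forall i l, modulus (u i l) <= (N i)%:R^-1) ->
  (forall i, modulus (c i) <= 1) ->
  lnorm (\sum_(i < m) c i *: u i) <= 5.
Proof.
move=> u1 uN uflat c1; apply: lnorm_le => s us.
have [s0|s0] := posnP (size s).
  by rewrite (size0nil s0) big_nil mulr_ge0 ?weight_sum_ge0.
apply: (@le_trans _ _ (\sum_(i < m) \sum_(l <- s) modulus (u i l))).
  rewrite exchange_big/=; apply: ler_sum => l _.
  rewrite dstar_sum (le_trans (ler_modulus_sum _ _ _))//.
  apply: ler_sum => i _; rewrite dstarZ modulusM ler_piMl ?modulus_ge0//.
have le_W (r : seq nat) i : uniq r -> \sum_(l <- r) modulus (u i l) <= W (size r).
  move=> ur; apply: le_trans (sum_modulus_le (u i) ur) _.
  by rewrite ler_piMl ?weight_sum_ge0.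
apply: (@fast_sum_le _ _ (fun i => \sum_(l <- s) modulus (u i l))) => // i.
- exact: le_W.
- rewrite (sum_modulus_supp us (uN i)).
  apply: le_trans (le_W _ _ (filter_uniq _ us)) _.
  by apply: weight_sum_mono => //; exact: size_filter_lt.
- apply: le_trans (ler_sum _ (fun l _ => uflat i l)) _.
  by rewrite big_const_seq count_predT iter_addr_0 -[leLHS]mulr_natl.
Qed.

End Fast.

(** Coordinates above [e] force [e * size s <= W (size s)], whereas [W] grows sublinearly; the bound
    is uniform over the ball. *)
Lemma count_large (e : R) : 0 < e -> exists m, forall (x : X) (s : seq nat),
  lnorm x <= 1 -> uniq s -> (forall i, i \in s -> e < modulus (x i)) ->
  (size s <= m)%N.
Proof.
move=> e0; have e20 : 0 < e / 2 by rewrite divr_gt0.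
have [c c0 hc] := weight_sum_sublinear hw e20.
have q0 : 0 <= c / (e / 2) by rewrite divr_ge0// ltW.
exists (Num.bound (c / (e / 2))) => x s x1 us sl.
rewrite -(ler_nat R); apply: le_trans (ltW (archi_boundP q0)).
rewrite ler_pdivlMr// mulrC.
have : e * (size s)%:R <= W (size s).
  apply: (@le_trans _ _ (\sum_(i <- s) modulus (x i))).
    rewrite mulr_natr -iter_addr_0 -(count_predT s) -big_const_seq.
    by rewrite !big_seq; apply: ler_sum => i /sl/ltW.
  apply: le_trans (sum_modulus_le x us) _.
  by rewrite ler_piMl ?weight_sum_ge0.
have := hc (size s); lra.
Qed.

End BlockSums.

(** * Forms vanishing along far blocks *)

(** The kinds of argument on which a form is tested. [Any] is reduced to [Tail] or [Fixed], and
    [Tail] to [Unit] or [Flat]; [slot_weight] counts what remains to be reduced. *)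
Variant slot := Fixed | Any | Tail | Unit | Flat.

Definition is_fixed t := if t is Fixed then true else false.
Definition is_tail t := match t with Fixed | Any => false | _ => true end.
Definition slot_weight t := match t with Any => 2%N | Tail => 1%N | _ => 0%N end.

Section Slots.
Variables (R : realType) (F : scalar_kind) (w : nat -> R) (hw : admissible w).
Local Notation K := (Kfield R F).
Local Notation W := (partial_sum w).
Local Notation X := (dstar F hw).
Local Notation e_ := (dunit F hw).
Implicit Types (t : slot) (x a : X).

(** Lets each block of a gliding hump end before the next one begins; general points are reached by
    approximation in [homogeneous_dtrunc_approx]. *)
Definition finsupp x : Prop := exists L, forall i, (L <= i)%N -> x i = 0.

Definition tail_ball n : set X :=
  [set x | [/\ lnorm x <= 1, finsupp x & forall i, (i < n)%N -> x i = 0]].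

(** The single parameter [n] governs both how far out a slot lives and how flat it is. *)
Definition slot_set t a n : set X :=
  match t with
  | Fixed => [set a]
  | Any => [set x | lnorm x <= 1 /\ finsupp x]
  | Tail => tail_ball n
  | Unit => [set x | exists2 j, (n <= j)%N & x = e_ j]
  | Flat => [set x | tail_ball n x /\ forall i, modulus (x i) <= n.+1%:R^-1]
  end.

Lemma slot_set_mono t a m n : (m <= n)%N -> slot_set t a n `<=` slot_set t a m.
Proof.
have tmono x : (m <= n)%N -> tail_ball n x -> tail_ball m x.
  by move=> mn [x1 fx x0]; split=> // i im; rewrite x0// (leq_trans im).
case: t => /= mn x //; first exact: (tmono x mn).
  by move=> [j nj ->]; exists j => //; exact: leq_trans nj.
move=> [tx xn]; split=> [|i]; first exact: (tmono x mn).
by apply: le_trans (xn i) _; rewrite lef_pV2 ?posrE// ler_nat.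
Qed.

Lemma finsupp_dunit j : finsupp (e_ j).
Proof. by exists j.+1 => i ji; rewrite dunitE gtn_eqF. Qed.

Lemma finsupp_dtrunc n x : finsupp (dtrunc hw n x).
Proof. by exists n => i; rewrite dtruncE leqNgt => /negbTE ->. Qed.

Lemma finsuppB x a : finsupp x -> finsupp a -> finsupp (x - a).
Proof.
move=> [L xL] [M aM]; exists (maxn L M) => i; rewrite geq_max => /andP[Li Mi].
by rewrite dstarB xL// aM// subrr.
Qed.

Lemma slot_finsupp t a n x : slot_set t a n x -> ~~ is_fixed t -> finsupp x.
Proof.
case: t => //= [[_ ?]|[_ ? _]|[j _ ->]|[[_ ?]]] // _; exact: finsupp_dunit.
Qed.

Lemma tail_in_ball n x : lnorm x <= 1 -> finsupp x ->
  tail_ball n (x - dtrunc hw n x).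
Proof.
move=> x1 fx; split.
- exact: le_trans (lnorm_tail _ _) x1.
- exact: finsuppB (finsupp_dtrunc _ _).
- by move=> i iN; rewrite dstarB dtruncE iN subrr.
Qed.

Variable d : nat.
Implicit Types (Phi : {ptws 'I_d -> X} -> K) (v z : 'I_d -> X) (s : 'I_d -> slot).

Definition null Phi s v : Prop := forall e : R, 0 < e -> exists n, forall z,
  (forall k, slot_set (s k) (v k) n (z k)) -> modulus (Phi z) <= e.

(** Says that [w] is not in l_r; [power_divergentP] is the link with [summable]. *)
Definition power_divergent (r : nat) : Prop :=
  forall T : R, exists m, T < \sum_(i < m) w i ^+ r.

Lemma power_divergent_le r q : (r <= q)%N -> power_divergent q -> power_divergent r.
Proof.
move=> rq h T; have [m hm] := h T; exists m; apply: lt_le_trans hm _.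
apply: ler_sum => i _; apply: ler_wiXn2l => //; first exact: admissible_ge0.
exact: weight_le1.
Qed.

(* Gliding hump: otherwise a fast sequence of blocks, scaled by the weights, has
   bounded signed sums, so that [diagonal_sum_modulus_le] bounds the partial sums
   of [w i ^+ r]. *)
Lemma null_base Phi s v : multilinear_form Phi -> continuous Phi ->
  (forall k, slot_weight (s k) = 0%N) ->
  let r := #|[set k | ~~ is_fixed (s k)]%SET| in
  (0 < r)%N -> power_divergent r -> null Phi s v.
Proof.
move=> hPhi cPhi s0; set live := [set k | _]%SET => r r0 pr e e0.
apply: contrapT => /forallNP nullN.
have /choice[z hz] : forall n, exists z,
    (forall k, slot_set (s k) (v k) n (z k)) /\ e < modulus (Phi z).
  move=> n; apply: contrapT => h; apply: (nullN n) => z hz.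
  by rewrite leNgt; apply/negP => ez; apply: h; exists z.
have liveE k : (k \in live) = ~~ is_fixed (s k) by rewrite finset.in_set.
have /choice[g hg] : forall n, exists m, [/\ (2 * n <= m)%N, 2 * W n <= W m &
    forall k i, k \in live -> (m <= i)%N -> z n k i = 0].
  move=> n.
  have /choice[L hL] : forall k : 'I_d, exists L, forall i, k \in live ->
      (L <= i)%N -> z n k i = 0.
    move=> k; have [kl|kl] := boolP (k \in live); last by exists 0%N.
    rewrite liveE in kl; have [L hL] := slot_finsupp ((hz n).1 k) kl.
    by exists L => i _; exact: hL.
  have [p Wp] := weight_sum_unbounded hw (2 * W n).
  exists (maxn (maxn (2 * n) p) (\max_k L k)); split.
  - by rewrite -maxnA leq_maxl.
  - apply: le_trans Wp _; apply: weight_sum_mono => //; lia.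
  - move=> k i kl mi; apply: hL => //; apply: leq_trans mi.
    by rewrite leq_max leq_bigmax orbT.
pose N i := iter i g 1%N.
have N2 i : (2 * N i <= N i.+1)%N by case: (hg (N i)).
have NW i : 2 * W (N i) <= W (N i.+1) by case: (hg (N i)).
have Nsupp i k l : k \in live -> (N i.+1 <= l)%N -> z (N i) k l = 0.
  by case: (hg (N i)) => _ _; apply.
have N0 : (0 < N 0)%N by [].
pose C : R := 5 + \sum_k lnorm (v k).
have sv0 : 0 <= \sum_k lnorm (v k) by apply: sumr_ge0 => k _; exact: lnorm_ge0.
have C0 : 0 < C by rewrite /C; lra.
have [C1 C10 hC1] := multilinear_bounded hPhi cPhi.
have hC := bounded_on_ball_scale hPhi C0 hC1.
(* Sums of unit vectors stay bounded when the coefficients are at most [w i], but not when they are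
   all 1; this is where the weights enter. *)
pose u k i := ofR F (w i) *: z (N i) k.
have [m hm] := pr (C ^+ d * C1 / e).
have wm i : modulus (ofR F (w i)) = w i.
  by rewrite ge0_modulus_ofR// admissible_ge0.
have hU k : k \in live -> sums_bounded m (u k) C.
  move=> kl c c1; apply: (@le_trans _ _ 5); last by rewrite /C lerDl.
  have := kl; rewrite liveE; have := s0 k; case sk : (s k) => // _ _.
    have /choice[j hj] : forall i, exists j, (N i <= j)%N /\ z (N i) k = e_ j.
      by move=> i; have := (hz (N i)).1 k; rewrite sk => -[j]; exists j.
    have jlt i : (j i < N i.+1)%N.
      rewrite ltnNge; apply/negP => /(Nsupp i k _ kl); rewrite (hj i).2 dunitE eqxx.
      by move/eqP; rewrite oner_eq0.
    have jS i : (j i < j i.+1)%N by apply: leq_trans (jlt i) _; case: (hj i.+1).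
    have jinj : injective j := incn_inj (leq_mono (homo_ltn ltn_trans jS)).
    apply: (@le_trans _ _ 1); last by rewrite ler1n.
    rewrite (eq_bigr (fun i : 'I_m => (c i * ofR F (w i)) *: e_ (j i))).
      apply: (sum_units_le hw m (c := fun i => c i * ofR F (w i))) => // i.
      rewrite modulusM wm ler_piMl ?admissible_ge0//.
    by move=> i _; rewrite /u scalerA (hj i).2.
  rewrite (eq_bigr (fun i : 'I_m => (c i * ofR F (w i)) *: z (N i) k)); last first.
    by move=> i _; rewrite /u scalerA.
  have hf i : tail_ball (N i) (z (N i) k) /\
      forall l, modulus (z (N i) k l) <= (N i).+1%:R^-1.
    by have := (hz (N i)).1 k; rewrite sk.
  apply: (sum_flat_le N0 N2 NW (u := fun i => z (N i) k) m
    (c := fun i => c i * ofR F (w i))) => [i|i l|i l|i].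
  - by have [[]] := hf i.
  - exact: Nsupp.
  - have [_ /(_ l) h] := hf i; apply: le_trans h _.
    by rewrite lef_pV2 ?posrE ?ltr0n ?ler_nat// (fast_gt0 N0 N2).
  - by rewrite modulusM wm mulr_ile1 ?modulus_ge0 ?admissible_ge0// weight_le1.
have hv k : k \notin live -> lnorm (v k) <= C.
  move=> _; rewrite /C (bigD1 k)//= addrCA lerDl addr_ge0// sumr_ge0// => j _.
  exact: lnorm_ge0.
have := diagonal_sum_modulus_le hPhi hC r0 hU hv.
apply/negP; rewrite -ltNge.
apply: (@lt_le_trans _ _ (\sum_(i < m) w i ^+ r * e)).
  by rewrite -mulr_suml -ltr_pdivrMr.
apply: ler_sum => i _.
(* Each of the [r] live slots releases one factor [w i]. *)
have -> : (fun k => if k \in live then u k i else v k) =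
    (fun k => (if k \in live then ofR F (w i) else 1) *: z (N i) k).
  apply/funext => k; case: ifP => [//|/negbT]; rewrite liveE negbK scale1r.
  by have := (hz (N i)).1 k; case: (s k) => //= ->.
rewrite ml_scale// -big_mkcond/= prodr_const modulusM modulusX wm -/r.
by rewrite ler_wpM2l ?exprn_ge0 ?admissible_ge0// ltW//; case: (hz (N i)).
Qed.

(* Only boundedly many coordinates of a vector of the ball exceed the level of a
   flat one, whence the two cases. *)
Lemma null_tail Phi s v k : multilinear_form Phi -> s k = Tail ->
  null Phi (dfwith s k Flat) v -> null Phi (dfwith s k Unit) v -> null Phi s v.
Proof.
move=> hPhi sk nF nU e e0; have e20 : 0 < e / 2 by rewrite divr_gt0.
(* The flat case fixes the level [1 / n1.+1], the level bounds the number [m] of large coordinates,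
   and [m] fixes the precision asked of the unit case. *)
have [n1 hn1] := nF _ e20.
have dl0 : 0 < n1.+1%:R^-1 :> R by rewrite invr_gt0.
have [m hm] := count_large F hw dl0.
have em0 : 0 < e / 2 / m.+1%:R by rewrite divr_gt0.
have [n2 hn2] := nU _ em0.
exists (maxn n1 n2) => z hz; set n := maxn n1 n2 in hz.
have := hz k; rewrite sk => -[zk1 [L zkL] zkn].
pose big_ := [pred i | n1.+1%:R^-1 < modulus (z k i)].
pose fl := dtrunc hw L (fun i => if big_ i then 0 else z k i).
have flE i : fl i = if big_ i then 0 else z k i.
  by rewrite dtruncE; case: ltnP => // /zkL ->; rewrite if_same.
pose r := [seq i <- iota 0 L | big_ i].
have ur : uniq r by rewrite filter_uniq ?iota_uniq.
have zkE : z k = fl + \sum_(i <- r) z k i *: e_ i.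
  apply: dstarP => i; rewrite dstarD flE dstar_sum.
  have [bi|bi] := boolP (big_ i).
    have ir : i \in r.
      rewrite mem_filter bi mem_iota /= add0n ltnNge; apply/negP => /zkL zi.
      by move: bi; rewrite /= zi modulus0 ltNge ltW.
    rewrite add0r (big_rem i)// dstarZ dunitE eqxx mulr1 big_seq big1.
      by rewrite [RHS]addr0.
    move=> j; rewrite rem_filter// mem_filter => /andP[/negbTE ji _].
    by rewrite dstarZ dunitE eq_sym ji mulr0.
  rewrite big_seq big1 ?addr0// => j; rewrite mem_filter => /andP[bj _].
  rewrite dstarZ dunitE; case: eqP => [ij|_]; last by rewrite mulr0.
  by rewrite ij bj in bi.
rewrite -(dfwith_id z k) zkE mlD// ml_sumZ//.
apply: le_trans (ler_modulusD _ _) _; rewrite [leRHS](splitr e); apply: lerD.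
  apply: hn1 => j; rewrite !dfwithE; case: (eqVneq k j) => [_|kj]; last first.
    exact: (slot_set_mono (leq_maxl _ _) (hz j)).
  have fz i : modulus (fl i) <= modulus (z k i).
    by rewrite flE; case: ifP => // _; rewrite modulus0 modulus_ge0.
  split; last first.
    move=> i; rewrite flE; case: ifP => [_|/negbT]; first by rewrite modulus0 ltW.
    by rewrite /= -leNgt.
  split; first by apply: le_trans zk1; exact: lnorm_mono.
    by exists L => i iL; rewrite flE zkL// if_same.
  move=> i iN; rewrite flE zkn ?if_same// (leq_trans iN)//; exact: leq_maxl.
apply: le_trans (ler_modulus_sum _ _ _) _.
apply: (@le_trans _ _ (\sum_(i <- r) e / 2 / m.+1%:R)).
  rewrite big_seq [leRHS]big_seq; apply: ler_sum => i.
  rewrite mem_filter => /andP[bi _]; rewrite modulusM.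
  have zi1 : modulus (z k i) <= 1 by rewrite (le_trans (modulus_coord_le _ _)).
  apply: le_trans (ler_piMl (modulus_ge0 _) zi1) _.
  apply: hn2 => j; rewrite !dfwithE; case: (eqVneq k j) => [_|kj]; last first.
    exact: (slot_set_mono (leq_maxr _ _) (hz j)).
  exists i => //; rewrite leqNgt; apply/negP => iN.
  move: bi; rewrite /= zkn ?modulus0 ?ltNge ?ltW// (leq_trans iN)//.
  exact: leq_maxr.
rewrite big_const_seq count_predT iter_addr_0 -[leLHS]mulr_natl mulrA ler_pdivrMr//.
rewrite mulrC ler_pM2l// ler_nat ltnW// ltnS (hm (z k))// => i.
by rewrite mem_filter => /andP[].
Qed.

Lemma null_any Phi s v k : multilinear_form Phi -> s k = Any ->
  null Phi (dfwith s k Tail) v ->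
  (forall a, null Phi (dfwith s k Fixed) (dfwith v k a)) -> null Phi s v.
Proof.
move=> hPhi sk nT nF e e0; have e20 : 0 < e / 2 by rewrite divr_gt0.
have [n1 hn1] := nT _ e20.
have em0 : 0 < e / 2 / n1.+1%:R by rewrite divr_gt0.
have /choice[f hf] : forall i, exists n, forall z,
    (forall j, slot_set (dfwith s k Fixed j) (dfwith v k (e_ i) j) n (z j)) ->
    modulus (Phi z) <= e / 2 / n1.+1%:R.
  by move=> i; exact: nF.
exists (maxn n1 (\max_(i < n1) f i)) => z hz; set n := maxn _ _ in hz.
have := hz k; rewrite sk => -[zk1 fzk].
rewrite -(dfwith_id z k) -(subrK (dtrunc hw n1 (z k)) (z k)) mlD//.
apply: le_trans (ler_modulusD _ _) _; rewrite [leRHS](splitr e); apply: lerD.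
  apply: hn1 => j; rewrite !dfwithE; case: (eqVneq k j) => [_|kj]; last first.
    exact: (slot_set_mono (leq_maxl _ _) (hz j)).
  exact: tail_in_ball.
rewrite dtrunc_sum ml_sumZ//; apply: le_trans (ler_modulus_sum _ _ _) _.
apply: (@le_trans _ _ (\sum_(i < n1) e / 2 / n1.+1%:R)).
  apply: ler_sum => i _; rewrite modulusM.
  have zi1 : modulus (z k i) <= 1 by rewrite (le_trans (modulus_coord_le _ _)).
  apply: le_trans (ler_piMl (modulus_ge0 _) zi1) _.
  apply: hf => j; rewrite !dfwithE; case: (eqVneq k j) => [_//|kj].
  apply: (slot_set_mono _ (hz j)); rewrite leq_max; apply/orP; right.
  exact: (@leq_bigmax _ (fun i : 'I_n1 => f i)).
rewrite sumr_const card_ord -[leLHS]mulr_natl mulrA ler_pdivrMr//.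
by rewrite mulrC ler_pM2l// ler_nat.
Qed.

(** Induction on the total [slot_weight]. Each reduction keeps some slot far out, so the base case
    has a live slot, and it has at most [d] of them. *)
Theorem null_forms Phi s v : multilinear_form Phi -> continuous Phi ->
  (exists k, is_tail (s k)) -> power_divergent d -> null Phi s v.
Proof.
move=> hPhi cPhi; have [p] := ubnP (\sum_k slot_weight (s k))%N.
elim: p s v => // p ih s v sp [k0 sk0] pd.
have wk k t : (slot_weight t < slot_weight (s k))%N ->
    (\sum_j slot_weight (dfwith s k t j) < p)%N.
  move=> tk; rewrite ltnS in sp; apply: leq_trans sp.
  rewrite (bigD1 k)//= [ltnRHS](bigD1 k)//= dfwithE eqxx.
  rewrite (eq_bigr (fun j => slot_weight (s j))) ?ltn_add2r// => j jk.
  by rewrite eq_sym (negbTE jk).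
have [/existsP[k /eqP sk]|/existsPn nA] :=
    boolP [exists k, slot_weight (s k) == 2%N].
  have {}sk : s k = Any by case: (s k) sk.
  have kk0 : k != k0 by apply: contraTneq sk0 => <-; rewrite sk.
  apply: (null_any hPhi sk) => [|a]; apply: ih => //.
  - by apply: wk; rewrite sk.
  - by exists k0; rewrite dfwithE (negbTE kk0).
  - by apply: wk; rewrite sk.
  - by exists k0; rewrite dfwithE (negbTE kk0).
have [/existsP[k /eqP sk]|/existsPn nT] :=
    boolP [exists k, slot_weight (s k) == 1%N].
  have {}sk : s k = Tail by case: (s k) sk.
  apply: (null_tail hPhi sk); apply: ih => //.
  - by apply: wk; rewrite sk.
  - by exists k; rewrite dfwithE eqxx.
  - by apply: wk; rewrite sk.
  - by exists k; rewrite dfwithE eqxx.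
apply: null_base => //.
- by move=> k; have := nA k; have := nT k; case: (s k).
- by apply/card_gt0P; exists k0; rewrite finset.in_set; case: (s k0) sk0.
- apply: power_divergent_le pd; rewrite -[leqRHS](card_ord d); exact: max_card.
Qed.

(** Telescoping from [x] to its truncation puts the tail of [x] into one slot and points of the ball
    into the others. *)
Theorem homogeneous_dtrunc_approx Phi : multilinear_form Phi -> continuous Phi ->
  power_divergent d -> forall e : R, 0 < e -> exists n, forall x, lnorm x <= 1 ->
  modulus (Phi (fun=> x) - Phi (fun=> dtrunc hw n x)) <= e.
Proof.
move=> hPhi cPhi pd e e0; have e20 : 0 < e / 2 by rewrite divr_gt0.
have ed0 : 0 < e / 2 / d.+1%:R by rewrite divr_gt0.
have /choice[f hf] : forall k : 'I_d, exists n, forall z,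
    (forall j, slot_set (dfwith (fun=> Any) k Tail j) 0 n (z j)) ->
    modulus (Phi z) <= e / 2 / d.+1%:R.
  move=> k; apply: (@null_forms _ (dfwith (fun=> Any) k Tail) (fun=> 0)) => //.
  by exists k; rewrite dfwithE eqxx.
have fin n x : (\max_k f k <= n)%N -> lnorm x <= 1 -> finsupp x ->
    modulus (Phi (fun=> x) - Phi (fun=> dtrunc hw n x)) <= e / 2.
  move=> fn x1 fx.
  apply: (@le_trans _ _ (\sum_(k < d) e / 2 / d.+1%:R)).
    apply: ml_telescope => // z k hz; apply: (hf k) => j.
    rewrite !dfwithE; case: (eqVneq k j) => [_|kj].
      have fkn : (f k <= n)%N by apply: leq_trans fn; exact: leq_bigmax.
      exact: (slot_set_mono (t := Tail) (a := 0) fkn (tail_in_ball n x1 fx)).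
    case: (hz j) => ->; first by [].
    split; last exact: finsupp_dtrunc.
    exact: le_trans (lnorm_dtrunc _ _) x1.
  rewrite sumr_const card_ord -[leLHS]mulr_natl mulrA ler_pdivrMr//.
  by rewrite mulrC ler_pM2l// ler_nat.
pose n := \max_k f k; exists n => x x1.
have [C C0 hC] := multilinear_bounded hPhi cPhi.
have eC0 : 0 < e / 2 / (C * d.+1%:R) by rewrite divr_gt0// mulr_gt0.
(* [L] depends on [x], but [n] does not: [y] has finite support and the same truncation at [n] as
   [x]. *)
have [L hL] := lnorm_tail_cvg x eC0.
pose y := dtrunc hw (maxn L n) x.
have yn : dtrunc hw n y = dtrunc hw n x.
  apply: dstarP => i; rewrite !dtruncE leq_max.
  by case: (i < n)%N; rewrite ?orbT.
have y1 : lnorm y <= 1 by exact: le_trans (lnorm_dtrunc _ _) x1.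
rewrite -(subrKA (Phi (fun=> y))) -yn.
apply: le_trans (ler_modulusD _ _) _; rewrite [leRHS](splitr e); apply: lerD.
  apply: le_trans (ml_lipschitz hPhi ltr01 hC (fun=> x1) (fun=> y1)) _.
  rewrite divr1 sumr_const card_ord.
  apply: (@le_trans _ _ (C * ((e / 2 / (C * d.+1%:R)) *+ d))).
    by rewrite ler_pM2l// ler_wMn2r// hL// leq_maxl.
  set q := e / 2 / _ in eC0 *; have -> : e / 2 = C * (q *+ d.+1).
    by rewrite -(mulr_natr q) mulrCA /q divfK// gt_eqF// mulr_gt0.
  by rewrite ler_pM2l// ler_wpMn2l// ltW.
by apply: fin => //; exact: finsupp_dtrunc.
Qed.

End Slots.

(** * Density *)

Section Summability.
Variables (R : realType) (w : nat -> R) (hw : admissible w).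

Lemma power_divergentP r :
  ~ summable [set: nat] (fun i => (w i ^+ r)%:E) <-> power_divergent w r.
Proof.
have w0 i : (0 <= `|(w i ^+ r)%:E|)%E by [].
have sumE m : (\sum_(0 <= i < m) `|(w i ^+ r)%:E|)%E = (\sum_(i < m) w i ^+ r)%:E.
  rewrite big_mkord -sumEFin; apply: eq_bigr => i _ /=.
  by rewrite ger0_norm// exprn_ge0 ?admissible_ge0.
rewrite /summable -nneseries_esumT//; split=> [ns T|pd].
  apply: contrapT => /forallNP bT; apply: ns.
  have bT' m : \sum_(i < m) w i ^+ r <= T by rewrite leNgt; apply/negP/bT.
  apply: (@le_lt_trans _ _ T%:E); last exact: ltry.
  have nd : {homo (fun m => \sum_(0 <= i < m) `|(w i ^+ r)%:E|)%E :
      a b / (a <= b)%N >-> (a <= b)%E} by exact: ereal_nondecreasing_series.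
  rewrite (cvg_lim _ (ereal_nondecreasing_cvgn nd))//.
  by apply: ge_ereal_sup => _ [m _ <-]; rewrite sumE lee_fin.
move=> s; have := @nneseries_lim_ge R (fun i => `|(w i ^+ r)%:E|)%E xpredT 0%N.
move: s; set S := limn _ => s h.
have Sm m : ((\sum_(i < m) w i ^+ r)%:E <= S)%E by rewrite -sumE; exact: h.
have S0 : (0 <= S)%E by apply: le_trans (Sm 0%N); rewrite big_ord0.
have [m] := pd (fine S); apply/negP; rewrite -leNgt -lee_fin fineK//.
by rewrite ge0_fin_numE.
Qed.

End Summability.

Section RealCoordinates.
Variables (R : realType) (F : scalar_kind).
Local Notation K := (Kfield R F).

(** Real coordinates for both scalar fields, so that finite-dimensional compactness comes from
    products of real segments. *)
Definition scalar_of (a b : R) : K :=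
  match F return Kfield R F with
  | RealScalars => a
  | ComplexScalars => (a +i* b)%C
  end.

Lemma scalar_ofB a b a' b' :
  scalar_of a b - scalar_of a' b' = scalar_of (a - a') (b - b').
Proof. by rewrite /scalar_of; case: F. Qed.

Lemma modulus_scalar_of a b : modulus (scalar_of a b) <= `|a| + `|b|.
Proof.
rewrite /scalar_of; case: F => /=; first by rewrite lerDl.
rewrite -(@ger0_norm _ (`|a| + `|b|)) ?addr_ge0// -sqrtr_sqr ler_sqrt ?sqr_ge0//.
rewrite sqrrD !real_normK ?num_real//.
by have : 0 <= `|a| * `|b| by []; lra.
Qed.

Lemma scalar_ofP (z : K) : modulus z <= 1 ->
  exists a b, [/\ `|a| <= 1, `|b| <= 1 & scalar_of a b = z].
Proof.
rewrite /scalar_of; case: F z => /= [z z1|[a b] h].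
  by exists z, 0; rewrite normr0.
exists a, b; split=> //; apply: le_trans h.
  by rewrite -sqrtr_sqr ler_sqrt ?lerDl ?sqr_ge0 ?addr_ge0 ?sqr_ge0.
by rewrite -sqrtr_sqr ler_sqrt ?lerDr ?sqr_ge0 ?addr_ge0 ?sqr_ge0.
Qed.

End RealCoordinates.

(** * Maxima on truncated balls and density of norm attaining polynomials *)

Section NormAttaining.
Variables (R : realType) (F : scalar_kind) (w : nat -> R) (hw : admissible w).
Local Notation K := (Kfield R F).
Local Notation X := (dstar F hw).
Implicit Types (P Q : X -> K).

Lemma poly_norm_le P (c : R) :
  (forall x : X, lnorm x <= 1 -> modulus (P x) <= c) -> poly_norm P <= c.
Proof.
move=> h; apply: ge_sup.
  exists (modulus (P 0)), 0 => //; apply/closed_unit_ballE.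
  by rewrite lnorm0.
by move=> _ [x /closed_unit_ballE x1 <-]; exact: h.
Qed.

Lemma le_poly_norm P (c : R) (x : X) :
  (forall y : X, lnorm y <= 1 -> modulus (P y) <= c) ->
  lnorm x <= 1 -> modulus (P x) <= poly_norm P.
Proof.
move=> h x1; apply: ub_le_sup.
  by exists c => _ [y /closed_unit_ballE y1 <-]; exact: h.
by exists x => //; apply/closed_unit_ballE.
Qed.

Lemma norm_attaining_max P (x0 : X) : lnorm x0 <= 1 ->
  (forall x : X, lnorm x <= 1 -> modulus (P x) <= modulus (P x0)) ->
  norm_attaining P.
Proof.
move=> x01 h; exists x0; first exact/closed_unit_ballE.
by apply/eqP; rewrite eq_le (le_poly_norm h)//=; exact: poly_norm_le.
Qed.

Lemma homogeneous_bounded n P : homogeneous_polynomials n P ->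
  exists c, forall x : X, lnorm x <= 1 -> modulus (P x) <= c.
Proof.
move=> [Phi [hPhi cPhi ->]]; have [C _ hC] := multilinear_bounded hPhi cPhi.
by exists C => x x1; apply: hC.
Qed.

Lemma homogeneous_dtrunc n L P : homogeneous_polynomials n P ->
  homogeneous_polynomials n (fun x : X => P (dtrunc hw L x)).
Proof.
move=> [Phi [hPhi cPhi ->]].
pose Psi (v : {ptws 'I_n -> X}) := Phi (fun k => dtrunc hw L (v k)).
have hPsi : multilinear_form Psi.
  move=> v i k a b; rewrite /Psi.
  have dfE x : (fun j => dtrunc hw L (dfwith v i x j)) =
      dfwith (fun j => dtrunc hw L (v j)) i (dtrunc hw L x).
    by apply/funext => j; rewrite !dfwithE; case: eqP.
  by rewrite !dfE dtruncD dtruncZ mlP.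
have [C _ hC] := multilinear_bounded hPhi cPhi.
exists Psi; split=> //.
apply: (@bounded_continuous _ _ _ _ _ Psi C) => // v v1; apply: hC => k.
exact: le_trans (lnorm_dtrunc _ _) (v1 k).
Qed.

Section FiniteDimensional.
Variables (L : nat) (P : X -> K).
Hypothesis cP : forall (x : X) (e : R), 0 < e -> exists2 d : R, 0 < d &
  forall y : X, lnorm (y - x) <= d -> modulus (P y - P x) <= e.

Let param := {ptws ('I_L * bool)%type -> R}.

Let point (v : param) : X :=
  \sum_(i < L) scalar_of F (v (i, true)) (v (i, false)) *: dunit F hw i.

Let pointB (u v : param) (e : R) : (forall k, `|u k - v k| <= e) ->
  lnorm (point u - point v) <= (2 * L%:R) * e.
Proof.
move=> uv; rewrite /point -sumrB; apply: le_trans (lnorm_sum _ _ _) _.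
apply: (@le_trans _ _ (\sum_(i < L) (e + e))).
  apply: ler_sum => i _; rewrite -scalerBl scalar_ofB lnormZ.
  apply: le_trans (ler_piMr (modulus_ge0 _) (lnorm_dunit _ _ _)) _.
  apply: le_trans (modulus_scalar_of _ _ _) _.
  by rewrite lerD.
rewrite sumr_const card_ord -[leLHS]mulr_natl; lra.
Qed.

Let point_continuous (f : X -> R) :
  (forall (x : X) (e : R), 0 < e -> exists2 d : R, 0 < d &
    forall y : X, lnorm (y - x) <= d -> `|f y - f x| <= e) ->
  continuous (f \o point : param -> R).
Proof.
move=> cf v.
have FF : Filter (nbhs (v : param)) by exact: nbhs_filter.
apply: (@cvgrPdist_le R R _ (nbhs (v : param)) FF (f \o point) _).2 => e e0.
have [d d0 hd] := cf (point v) e e0.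
have d'0 : 0 < d / (2 * L.+1%:R) by rewrite divr_gt0// mulr_gt0.
have : \forall u \near (v : param), forall k, `|v k - u k| < d / (2 * L.+1%:R).
  apply: (@filter_forall _ _ (fun k (u : param) =>
    `|v k - u k| < d / (2 * L.+1%:R)) _ FF) => k.
  have := @proj_continuous _ (fun=> R) k v.
  by move=> /cvgrPdist_lt/(_ _ d'0).
apply: filterS => u uv; rewrite distrC; apply: hd.
apply: le_trans (pointB (e := d / (2 * L.+1%:R)) _) _.
  by move=> k; rewrite distrC ltW.
rewrite mulrA ler_pdivrMr ?mulr_gt0// mulrC ler_pM2l// ler_pM2l//.
by rewrite ler_nat.
Qed.

(** Truncation maps the ball onto the image under [point] of the compact parameter set [A], so a
    maximum over [A] is a maximum over the ball. *)
Lemma dtrunc_norm_attaining : norm_attaining (fun x : X => P (dtrunc hw L x)).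
Proof.
pose A : set param :=
  [set v | (forall k, `[(-1 : R), 1]%classic (v k)) /\ lnorm (point v) <= 1].
have cA : compact A.
  have cB : compact [set v : param | forall k, `[(-1 : R), 1]%classic (v k)].
    exact: (@tychonoff ('I_L * bool)%type (fun=> R) (fun=> `[(-1 : R), 1]%classic)
      (fun=> @segment_compact _ _ _)).
  apply: (compact_closedI cB).
  apply: (@closed_comp _ _ (@lnorm R F w hw \o point) [set r | r <= 1]).
    move=> v _; apply: point_continuous => x e e0; exists e => // y yx.
    exact: le_trans (ler_dist_lnorm _ _) yx.
  exact: closed_le.
have pE (x : X) : lnorm x <= 1 -> exists2 v, A v & point v = dtrunc hw L x.
  move=> x1.
  have /choice[c hc] : forall i : 'I_L, exists c : R * R,
      [/\ `|c.1| <= 1, `|c.2| <= 1 & scalar_of F c.1 c.2 = x i].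
    move=> i; have [|a [b h]] := @scalar_ofP R F (x i).
      exact: le_trans (modulus_coord_le _ _) x1.
    by exists (a, b).
  pose v : param := fun k => if k.2 then (c k.1).1 else (c k.1).2.
  have pv : point v = dtrunc hw L x.
    rewrite dtrunc_sum; apply: eq_bigr => i _; rewrite /v/=.
    by have [_ _ ->] := hc i.
  exists v => //; split; last by rewrite pv (le_trans (lnorm_dtrunc _ _)).
  move=> [i b]; rewrite /= in_itv/= -ler_norml /v/=.
  by have [] := hc i; case: b.
have A0 : A !=set0 by have [|v Av _] := pE 0; [rewrite lnorm0|exists v].
pose f (x : X) := modulus (P x).
have cf : {within A, continuous (f \o point : param -> R)}.
  apply: continuous_subspaceT; apply: point_continuous => x e e0.
  have [d d0 hd] := cP x e0; exists d => // y /hd; apply: le_trans.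
  exact: ler_dist_modulus.
have [c] := compact_EVT_max A0 cA cf; rewrite inE => -[_ c1] cmax.
(* The maximizer is its own truncation, hence the value is attained at a point of the ball. *)
have trp : dtrunc hw L (point c) = point c.
  apply: dstarP => j; rewrite dtruncE; case: ltnP => // Lj.
  rewrite /point dstar_sum big1// => i _; rewrite dstarZ dunitE gtn_eqF ?mulr0//.
  exact: leq_trans (ltn_ord i) Lj.
apply: (@norm_attaining_max _ (point c)) => // x /pE[v Av <-].
by rewrite trp; apply: cmax; rewrite inE.
Qed.

End FiniteDimensional.

Theorem norm_attaining_dense n : power_divergent w n ->
  dense_in (norm_attaining (V := X) `&` homogeneous_polynomials n)
    (homogeneous_polynomials n).
Proof.
move=> pd; split=> [P []//|P hP e e0].
have [Phi [hPhi cPhi PE]] := hP.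
have e20 : 0 < e / 2 by rewrite divr_gt0.
have [L hL] := homogeneous_dtrunc_approx hPhi cPhi pd e20.
exists (fun x : X => P (dtrunc hw L x)); last first.
  apply: (@le_lt_trans _ _ (e / 2)); last by lra.
  by apply: poly_norm_le => x x1; rewrite PE; exact: hL.
split; last exact: homogeneous_dtrunc.
apply: dtrunc_norm_attaining => x r r0; rewrite PE.
have [C C0 hC] := multilinear_bounded hPhi cPhi.
pose B := lnorm x + 1.
have B1 : 1 <= B by rewrite lerDr lnorm_ge0.
have B0 : 0 < B by exact: lt_le_trans B1.
have hB := bounded_on_ball_scale hPhi B0 hC.
set C' := _ * C in hB.
have C'0 : 0 < C' by rewrite mulr_gt0// exprn_gt0.
pose q := C' / B * n.+1%:R.
have q0 : 0 < q by rewrite mulr_gt0// divr_gt0.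
exists (Num.min 1 (r / q)); first by rewrite lt_min ltr01 divr_gt0.
move=> y; rewrite le_min => /andP[yx1 yxq].
have xB : lnorm x <= B by rewrite lerDl.
have yB : lnorm y <= B.
  by rewrite -(subrK x y) addrC (le_trans (lnormD _ _))// lerD2l.
apply: le_trans (ml_lipschitz hPhi B0 hB (fun=> yB) (fun=> xB)) _.
rewrite sumr_const card_ord -[X in _ * X]mulr_natl mulrA.
apply: (@le_trans _ _ (q * lnorm (y - x))).
  by rewrite ler_wpM2r ?lnorm_ge0// ler_wpM2l ?ler_nat// divr_ge0// ltW.
by rewrite -ler_pdivlMl// mulrC.
Qed.

End NormAttaining.

(** * Scalar series and polynomials *)

Section AbsoluteSums.
Variables (R : realType) (F : scalar_kind).
Local Notation K := (Kfield R F).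
Implicit Types (f g : nat -> K) (l : K).

Definition isum f l : Prop := forall e : R, 0 < e -> exists n, forall m,
  (n <= m)%N -> modulus (\sum_(i < m) f i - l) <= e.

Definition abs_bounded f (S : R) : Prop :=
  forall m, \sum_(i < m) modulus (f i) <= S.

(** The partial sums are those of [|u| + u] minus those of [|u|], two nondecreasing bounded
    sequences. *)
Lemma real_series_cvg (u : nat -> R) (S : R) :
  (forall m, \sum_(i < m) `|u i| <= S) -> exists l : R, forall e : R, 0 < e ->
  exists n, forall m, (n <= m)%N -> `|\sum_(i < m) u i - l| <= e.
Proof.
move=> uS.
pose a m := \sum_(i < m) (`|u i| + u i); pose b m := \sum_(i < m) `|u i|.
have ca : cvgn a.
  apply: nondecreasing_is_cvgn.
    apply/nondecreasing_seqP => n; rewrite /a big_ord_recr/= lerDl.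
    by rewrite -lerBlDr sub0r ler_normr lexx orbT.
  exists (S + S) => _ [m _ <-]; rewrite /a big_split/= lerD ?uS//.
  by apply: le_trans (uS m); apply: ler_sum => i _; exact: ler_norm.
have cb : cvgn b.
  apply: nondecreasing_is_cvgn.
    by apply/nondecreasing_seqP => n; rewrite /b big_ord_recr/= lerDl.
  by exists S => _ [m _ <-]; exact: uS.
exists (limn a - limn b) => e e0.
have : a m - b m @[m --> \oo] --> limn a - limn b by exact: cvgB.
move=> /cvgrPdist_le/(_ _ e0) [n _ h]; exists n => m nm.
have := h m nm; rewrite /= distrC /a /b -sumrB.
by congr (`| _ - _ | <= _); apply: eq_bigr => i _; lra.
Qed.

Lemma isum_exists f (S : R) : abs_bounded f S -> exists l, isum f l.
Proof.
rewrite /isum /abs_bounded; case: F f => /= f fS; first exact: real_series_cvg fS.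
have le_Re z : `|complex.Re z| <= ComplexField.Normc.normc z :> R.
  case: z => a b /=; rewrite -sqrtr_sqr ler_sqrt ?lerDl ?sqr_ge0//.
  by rewrite addr_ge0 ?sqr_ge0.
have le_Im z : `|complex.Im z| <= ComplexField.Normc.normc z :> R.
  case: z => a b /=; rewrite -sqrtr_sqr ler_sqrt ?lerDr ?sqr_ge0//.
  by rewrite addr_ge0 ?sqr_ge0.
have RS m : \sum_(i < m) `|complex.Re (f i)| <= S.
  by apply: le_trans (fS m); apply: ler_sum => i _.
have IS m : \sum_(i < m) `|complex.Im (f i)| <= S.
  by apply: le_trans (fS m); apply: ler_sum => i _.
have [a ha] := real_series_cvg (u := fun i => complex.Re (f i)) RS.
have [b hb] := real_series_cvg (u := fun i => complex.Im (f i)) IS.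
exists (a +i* b)%C => e e0; have e20 : 0 < e / 2 by rewrite divr_gt0.
have [n1 h1] := ha _ e20; have [n2 h2] := hb _ e20.
exists (maxn n1 n2) => m; rewrite geq_max => /andP[/h1 {}h1 /h2 {}h2].
have -> : \sum_(i < m) f i =
    ((\sum_(i < m) complex.Re (f i)) +i* (\sum_(i < m) complex.Im (f i)))%C.
  elim: m {h1 h2} => [|m ih]; first by rewrite !big_ord0.
  by rewrite !big_ord_recr /= ih; case: (f m).
apply: le_trans (@modulus_scalar_of R ComplexScalars _ _) _.
by rewrite (splitr e) lerD.
Qed.

Lemma isum_unique f l l' : isum f l -> isum f l' -> l = l'.
Proof.
move=> hl hl'; apply/eqP; rewrite -subr_eq0; apply/eqP/modulus_eq0.
apply/eqP; rewrite eq_le modulus_ge0 andbT; apply/ler_addgt0Pr => e e0.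
have e20 : 0 < e / 2 by rewrite divr_gt0.
have [n1 h1] := hl _ e20; have [n2 h2] := hl' _ e20.
rewrite add0r (splitr e) -(subrKA (\sum_(i < maxn n1 n2) f i)).
apply: le_trans (ler_modulusD _ _) _; apply: lerD.
  by rewrite modulusB h1// leq_maxl.
by rewrite h2// leq_maxr.
Qed.

Lemma isum_lin (k : K) f g l l' : isum f l -> isum g l' ->
  isum (fun i => k * f i + g i) (k * l + l').
Proof.
move=> hl hl' e e0; have k0 := modulus_ge0 k.
have k1 : 0 < modulus k + 1 by rewrite ltr_wpDl.
have e20 : 0 < e / 2 by rewrite divr_gt0.
have ek0 : 0 < e / 2 / (modulus k + 1) by rewrite divr_gt0.
have [n1 h1] := hl _ ek0; have [n2 h2] := hl' _ e20.
exists (maxn n1 n2) => m; rewrite geq_max => /andP[/h1 {}h1 /h2 {}h2].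
rewrite big_split/= -mulr_sumr opprD addrACA -mulrBr.
apply: le_trans (ler_modulusD _ _) _; rewrite (splitr e) lerD//.
rewrite modulusM; apply: le_trans (ler_wpM2l k0 h1) _.
by rewrite mulrA ler_pdivrMr// mulrC ler_pM2l// lerDl.
Qed.

Lemma isum_le f l (S : R) : abs_bounded f S -> isum f l -> modulus l <= S.
Proof.
move=> fS hl; apply/ler_addgt0Pr => e e0; have [n /(_ n (leqnn n)) h] := hl _ e0.
have -> : l = \sum_(i < n) f i - (\sum_(i < n) f i - l) by rewrite subKr.
apply: le_trans (ler_modulusB _ _) _; rewrite lerD//.
exact: le_trans (ler_modulus_sum _ _ _) (fS n).
Qed.

Lemma isum_single f n : (forall i, i != n -> f i = 0) -> isum f (f n).
Proof.
move=> f0 e e0; exists n.+1 => m nm.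
rewrite (bigD1 (Ordinal nm))//= big1 => [|i]; last by rewrite -val_eqE/= => /f0.
by rewrite addr0 subrr modulus0 ltW.
Qed.

End AbsoluteSums.

(** * Coefficient estimates and directions of growth *)

Section PolynomialCoefficients.
Variables (R : realType) (F : scalar_kind).
Local Notation K := (Kfield R F).

(* Induction on the degree: [2 ^ n.+1 * p (t / 2) - p t] has no leading term. *)
Lemma poly_coef_le (n : nat) : exists2 C : R, 0 <= C &
  forall (a : nat -> K) (e : R), 0 <= e ->
  (forall t : R, 0 <= t <= 2^-1 ->
    modulus (\sum_(j < n.+1) ofR F t ^+ j * a j) <= e) ->
  forall j, (j <= n)%N -> modulus (a j) <= C * e.
Proof.
elim: n => [|n [C C0 ih]].
  exists 1 => // a e e0 h j; rewrite leqn0 => /eqP ->.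
  have := h 0; rewrite lexx invr_ge0 ler0n => /(_ isT).
  by rewrite big_ord1 expr0 !mul1r.
pose D : R := 2 ^+ n.+1 + 1.
have D0 : 0 <= D by rewrite addr_ge0// exprn_ge0.
pose C' := C * D.
have C'0 : 0 <= C' by rewrite mulr_ge0.
exists (C' + 2 ^+ n.+1 * (1 + n.+1%:R * C')).
  by rewrite addr_ge0// mulr_ge0 ?exprn_ge0// addr_ge0// mulr_ge0.
move=> a e e0 h.
(* [q j] is the factor of [a j] in [2 ^ n.+1 * p (t / 2) - p t]; it is zero in the top degree and at
   least 1 below. *)
pose q j : R := 2 ^+ n.+1 * 2^-1 ^+ j - 1.
have q1 j : (j <= n)%N -> 1 <= q j.
  move=> jn; rewrite /q lerBrDr exprVn -expfB// ?ltnS//.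
  apply: (@le_trans _ _ (2 ^+ 1)) => //.
  by rewrite ler_eXn2l ?ltr1n// subn_gt0 ltnS.
have low j : (j <= n)%N -> modulus (a j) <= C' * e.
  move=> jn; have := ih (fun j => ofR F (q j) * a j) (D * e) _ _ j jn.
  rewrite modulusM ge0_modulus_ofR ?(le_trans ler01 (q1 _ jn))//.
  rewrite /C' -mulrA => h'; apply: le_trans (h' _ _).
  - by rewrite ler_peMl ?modulus_ge0// q1.
  - by rewrite mulr_ge0.
  move=> t /andP[t0 t1].
  have -> : \sum_(i < n.+1) ofR F t ^+ i * (ofR F (q i) * a i) =
      ofR F (2 ^+ n.+1) * \sum_(i < n.+2) ofR F (t / 2) ^+ i * a i -
      \sum_(i < n.+2) ofR F t ^+ i * a i.
    rewrite mulr_sumr -sumrB [RHS]big_ord_recr/= [X in _ = _ + X](_ : _ = 0).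
      rewrite addr0; apply: eq_bigr => i _.
      rewrite -!ofRX !mulrA -!ofRM -mulrBl -ofRN -ofRD; congr (ofR F _ * _).
      by rewrite /q exprMn; lra.
    rewrite -!ofRX !mulrA -!ofRM exprMn -mulrBl -ofRN -ofRD.
    rewrite [X in ofR F X](_ : _ = 0) ?ofR0 ?mul0r//.
    rewrite mulrCA -exprMn mulfV// expr1n; lra.
  apply: le_trans (ler_modulusB _ _) _.
  rewrite /D mulrDl mul1r lerD// ?h ?t0//.
  rewrite modulusM ge0_modulus_ofR ?exprn_ge0// ler_pM2l ?exprn_gt0//.
  by apply: h; apply/andP; split; lra.
have P2 : 0 < 2 ^+ n.+1 :> R by rewrite exprn_gt0.
have pos : 0 <= 2 ^+ n.+1 * (1 + n.+1%:R * C') * e.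
  by rewrite mulr_ge0// mulr_ge0 ?(ltW P2)// addr_ge0// mulr_ge0.
move=> j; rewrite leq_eqVlt => /orP[/eqP ->|]; last first.
  by rewrite ltnS => /low h'; rewrite mulrDl; lra.
have h2 : 0 <= (2^-1 : R) <= 2^-1 by rewrite lexx invr_ge0 ler0n.
have := h _ h2; rewrite big_ord_recr/= => htop.
have hs : modulus (\sum_(i < n.+1) ofR F 2^-1 ^+ i * a i) <= n.+1%:R * (C' * e).
  apply: le_trans (ler_modulus_sum _ _ _) _.
  rewrite mulr_natl -[in leRHS](card_ord n.+1) -sumr_const; apply: ler_sum => i _.
  rewrite modulusM modulusX ge0_modulus_ofR ?invr_ge0//.
  apply: le_trans (low i _); last by rewrite -ltnS.
  rewrite ler_piMl ?modulus_ge0// exprn_ile1 ?invr_ge0//.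
  by rewrite invf_le1// ler1n.
have : modulus (ofR F 2^-1 ^+ n.+1 * a n.+1) <= e + n.+1%:R * (C' * e).
  set s := \sum_(i < _) _ in htop hs; set t := _ * a n.+1 in htop *.
  rewrite -[t](addKr s) addrC; apply: le_trans (ler_modulusB _ _) _.
  by rewrite lerD.
rewrite modulusM modulusX ge0_modulus_ofR ?invr_ge0// exprVn ler_pdivrMl//.
have := mulr_ge0 C'0 e0; nra.
Qed.

(** The condition for making [a * u ^+ n] a positive multiple of [b] when [n] is even; complex roots
    always exist, so nothing is asked there. *)
Definition same_sign (a b : K) : Prop :=
  match F return Kfield R F -> Kfield R F -> Prop with
  | RealScalars => fun a b => 0 < a * b
  | ComplexScalars => fun _ _ => True
  end a b.

Lemma same_sign_near (a b : K) : modulus (a - b) < modulus b -> same_sign a b.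
Proof.
rewrite /same_sign; case: F a b => //= a b; rewrite lter_norml.
case: (ltgtP b 0) => [b0|b0|->].
- by rewrite ltr0_norm// nmulr_lgt0// => /andP[h1 h2]; lra.
- by rewrite gtr0_norm// pmulr_lgt0// => /andP[h1 h2]; lra.
- by rewrite normr0 => /andP[h1 h2]; lra.
Qed.

Lemma same_sign_sym (a b : K) : same_sign a b -> same_sign b a.
Proof. by rewrite /same_sign; case: F a b => //= a b; rewrite mulrC. Qed.

Lemma same_sign_trans (a b c : K) : same_sign a b -> same_sign b c -> same_sign a c.
Proof. rewrite /same_sign; case: F a b c => //= a b c; nra. Qed.

Lemma unimodular_root (n : nat) (r : K) : (0 < n)%N -> modulus r = 1 ->
  (~~ odd n -> same_sign r 1) -> exists2 u : K, modulus u = 1 & u ^+ n = r.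
Proof.
rewrite /same_sign; case: F r => /= r n0 r1; last first.
  move=> _; exists (n.-root r); last exact: rootCK.
  apply/eqP; rewrite -(pexpr_eq1 n0) ?(@modulus_ge0 _ ComplexScalars)//.
  have := @modulusX R ComplexScalars (n.-root r) n.
  by rewrite /= rootCK// r1 => <-.
rewrite mulr1 => h; exists r => //.
have /eqP := r1; rewrite eqr_norml ler01 andbT => /orP[/eqP ->|/eqP r_1].
  by rewrite expr1n.
have : odd n by apply: contraPT h; rewrite r_1 => on /(_ on); lra.
by rewrite r_1 -signr_odd => ->; rewrite expr1.
Qed.

(** With [u] a root of [c * b / a], the product [a * u ^+ n] is a positive multiple of [b], and the
    triangle inequality becomes an equality. *)
Lemma aligned_direction (n : nat) (a b : K) : (0 < n)%N -> a != 0 -> b != 0 ->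
  (~~ odd n -> same_sign a b) -> exists2 u : K, modulus u = 1 &
  forall t : R, 0 <= t ->
    modulus (b + a * u ^+ n * ofR F t) = modulus b + modulus a * t.
Proof.
move=> n0 a0 b0 ab; have ma := modulus_gt0 a0; have mb := modulus_gt0 b0.
pose c := ofR F (modulus a / modulus b).
have mc : modulus c = modulus a / modulus b.
  by rewrite ge0_modulus_ofR// divr_ge0// ltW.
have [|on|u u1 ur] := @unimodular_root n (c * b / a) n0.
- apply: (mulIf (lt0r_neq0 ma)); rewrite -modulusM divfK// modulusM mc mul1r.
  by rewrite divfK// gt_eqF.
- have := ab on; rewrite /same_sign /c; clear -ma mb a0 b0.
  case: F a b a0 b0 ma mb => //= a b a0 b0 ma mb ab.
  rewrite mulr1 -mulrA; apply: mulr_gt0; first exact: divr_gt0.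
  have -> : b / a = a * b / a ^+ 2 by field.
  by rewrite divr_gt0// exprn_even_gt0.
exists u => // t t0; rewrite ur.
have -> : b + a * (c * b / a) * ofR F t =
    b * ofR F (1 + modulus a / modulus b * t).
  rewrite ofRD ofR1 ofRM -/c mulrDr mulr1; congr (_ + _).
  by rewrite [a * _]mulrC divfK// mulrA [b * c]mulrC.
have q0 : 0 <= modulus a / modulus b * t by rewrite mulr_ge0// divr_ge0// ltW.
rewrite modulusM ge0_modulus_ofR ?addr_ge0// mulrDr mulr1 mulrA; congr (_ + _ * _).
by rewrite mulrC divfK// gt_eqF.
Qed.

End PolynomialCoefficients.

(** * The extremal polynomial *)

Section Majorization.
Variables (R : realType) (F : scalar_kind) (w : nat -> R) (hw : admissible w).
Local Notation K := (Kfield R F).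
Local Notation X := (dstar F hw).

Lemma abel_le (c u g : nat -> R) :
  (forall n, \sum_(i < n) c i <= \sum_(i < n) u i) ->
  (forall i, 0 <= g i) -> (forall i, g i.+1 <= g i) ->
  forall n, \sum_(i < n) c i * g i <= \sum_(i < n) u i * g i.
Proof.
move=> cu g0 gd [|n]; first by rewrite !big_ord0.
rewrite -subr_ge0 -sumrB.
under eq_bigr do rewrite -mulrBl.
have D0 m : 0 <= \sum_(i < m) (u i - c i) by rewrite sumrB subr_ge0.
(* Summation by parts, as an induction: the last value of [g] times the full sum of [u - c] is a
   lower bound that survives passing to a smaller [g]. *)
apply: (@le_trans _ _ (g n * \sum_(i < n.+1) (u i - c i))).
  by rewrite mulr_ge0 ?D0.
elim: n => [|n ih]; first by rewrite !big_ord1 mulrC.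
rewrite big_ord_recr mulrDr [leRHS]big_ord_recr/= [g n.+1 * (_ - _)]mulrC lerD2r.
by apply: le_trans ih; rewrite ler_wpM2r ?D0.
Qed.

(** Weak majorization passes to powers: the factors [c i] are traded for [w i] one at a time, the
    remaining mixed product being a nonincreasing multiplier for [abel_le]. *)
Lemma power_sum_le (c : nat -> R) (M n : nat) :
  (forall i, 0 <= c i) -> (forall i, c i.+1 <= c i) ->
  (forall m, \sum_(i < m) c i <= partial_sum w m) ->
  \sum_(i < n) c i ^+ M <= \sum_(i < n) w i ^+ M.
Proof.
move=> c0 cd cW.
suff h b a : \sum_(i < n) c i ^+ b * w i ^+ a <= \sum_(i < n) w i ^+ (b + a).
  have := h M 0%N; rewrite addn0; apply: le_trans.
  by apply: ler_sum => i _; rewrite expr0 mulr1.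
elim: b a => [|b ih] a; first by under eq_bigr do rewrite expr0 mul1r.
have := ih a.+1; rewrite addnS; apply: le_trans.
under eq_bigr do rewrite exprS -mulrA.
under [leRHS]eq_bigr do rewrite exprS mulrCA.
apply: (@abel_le c w (fun i => c i ^+ b * w i ^+ a)) => // i.
  by rewrite mulr_ge0 ?exprn_ge0// admissible_ge0.
have w0 := admissible_ge0 hw.
apply: ler_pM; rewrite ?exprn_ge0// ?lerXn2r ?nnegrE//.
exact: admissible_nonincreasing.
Qed.

(** Sort the moduli decreasingly and pad with zeros to apply [power_sum_le]. Thus if [w] is in l_M,
    so is the whole space. *)
Lemma lnorm_power_sum (x : X) (M : nat) (s : seq nat) : lnorm x <= 1 -> uniq s ->
  \sum_(i <- s) modulus (x i) ^+ M <= \sum_(i < size s) w i ^+ M.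
Proof.
move=> x1 us; pose leT := relpre (fun i => modulus (x i)) (fun a b : R => b <= a).
have leTT : total leT by move=> i j; rewrite /leT/= orbC le_total.
have leTr : transitive leT by move=> j i k; rewrite /leT/= => h1 h2; apply: le_trans h1.
pose t := sort leT s.
have ts : perm_eq t s by rewrite perm_sort.
have ut : uniq t by rewrite sort_uniq.
have st : size t = size s by rewrite size_sort.
pose c k := if (k < size t)%N then modulus (x (nth 0%N t k)) else 0.
have sumE (f : R -> R) n : (n <= size t)%N ->
    \sum_(k < n) f (c k) = \sum_(i <- take n t) f (modulus (x i)).
  move=> nt; rewrite (big_nth 0%N) size_takel// big_mkord; apply: eq_bigr => k _.
  by rewrite /c (leq_trans (ltn_ord k) nt) nth_take.
rewrite -(perm_big _ ts)/= -{1}(take_size t).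
rewrite -(sumE (fun r => r ^+ M))// st.
apply: power_sum_le => [i|i|m].
- by rewrite /c; case: ifP => // _; exact: modulus_ge0.
- rewrite /c; case: (ltnP i.+1 (size t)) => it; last first.
    by case: ifP => // _; exact: modulus_ge0.
  rewrite (ltnW it); have := @sorted_ltn_nth _ _ leTr 0%N t (sort_sorted leTT s).
  by move=> /(_ i i.+1); rewrite !inE (ltnW it) it ltnSn; apply.
have le_t n : (n <= size t)%N -> \sum_(k < n) c k <= partial_sum w n.
  move=> nt; rewrite (sumE id)//.
  apply: le_trans (sum_modulus_le x _) _; first exact: take_uniq.
  by rewrite size_takel// ler_piMl ?weight_sum_ge0.
have [mt|tm] := leqP m (size t); first exact: le_t.
apply: le_trans (weight_sum_mono hw (ltnW tm)); apply: le_trans (le_t _ (leqnn _)).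
rewrite -(subnK (ltnW tm)) addnC big_split_ord/= [X in _ + X]big1 ?addr0// => k _.
by rewrite /c ltnNge leq_addr.
Qed.

End Majorization.

(** * The form behind the extremal polynomial *)

Section ExtremalForm.
Variables (R : realType) (F : scalar_kind) (w : nat -> R) (hw : admissible w).
Local Notation K := (Kfield R F).
Local Notation X := (dstar F hw).
Local Notation e_ := (dunit F hw).
Variables (N M : nat) (S : R).
Hypotheses (M0 : (0 < M)%N) (MN : (M <= N)%N)
  (wS : forall m, \sum_(i < m) w i ^+ M <= S).
Implicit Types (v : 'I_N -> X) (k l : 'I_N) (x : X).

Let low : pred 'I_N := fun l => (l < M)%N.

Lemma card_low : #|low| = M.
Proof. by rewrite -sum1_card big_ord_narrow// sum1_card card_ord. Qed.

(** The largest of the [M] factors, raised to the power [M], is one of the summands; a crude bound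
    that suffices for convergence. *)
Lemma prod_le_sum_power (a : 'I_N -> R) : (forall l, 0 <= a l) ->
  \prod_(l | low l) a l <= \sum_(l | low l) a l ^+ M.
Proof.
move=> a0; have low0 : low (Ordinal (leq_trans M0 MN)) by [].
case: (@arg_maxP _ R _ _ low a low0) => i li imax.
apply: (@le_trans _ _ (a i ^+ M)).
  rewrite -card_low -prodr_const; apply: ler_prod => l ll.
  by rewrite a0/=; exact: imax.
by rewrite (bigD1 i)//= lerDl sumr_ge0// => l _; rewrite exprn_ge0.
Qed.

Definition coord_prod (P : pred 'I_N) v i : K := \prod_(l | P l) v l i.

Lemma coord_prod_dfwith (P : pred 'I_N) v k x i :
  coord_prod P (dfwith v k x) i =
  if P k then x i * \prod_(l | P l && (l != k)) v l i else coord_prod P v i.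
Proof.
rewrite /coord_prod; case: ifP => Pk.
  rewrite (bigD1 k)//= dfwithE eqxx; congr (_ * _).
  by apply: eq_bigr => l /andP[_ lk]; rewrite eq_sym (negbTE lk).
apply: eq_bigr => l Pl; rewrite dfwithE; case: eqP => // kl.
by rewrite -kl Pk in Pl.
Qed.

Lemma coord_prod_lin (P : pred 'I_N) v k (c : K) x y i : P k ->
  coord_prod P (dfwith v k (c *: x + y)) i =
  c * coord_prod P (dfwith v k x) i + coord_prod P (dfwith v k y) i.
Proof. by move=> Pk; rewrite !coord_prod_dfwith Pk dstarD dstarZ mulrDl mulrA. Qed.

Lemma coord_prod_bounded v : (forall l, lnorm (v l) <= 1) ->
  abs_bounded (coord_prod low v) (N%:R * S).
Proof.
move=> v1 m; have S0 : 0 <= S by apply: le_trans (wS 0); rewrite big_ord0.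
apply: (@le_trans _ _ (\sum_(i < m) \sum_(l | low l) modulus (v l i) ^+ M)).
  apply: ler_sum => i _; rewrite modulus_prod; apply: prod_le_sum_power => l.
  exact: modulus_ge0.
rewrite exchange_big/=; apply: (@le_trans _ _ (\sum_(l | low l) S)).
  apply: ler_sum => l _; apply: le_trans (wS m).
  have := lnorm_power_sum M (v1 l) (iota_uniq 0 (m - 0)).
  by rewrite size_iota -/(index_iota 0 m) big_mkord subn0.
rewrite sumr_const card_low -[leLHS]mulr_natl ler_wpM2r// ler_nat//.
Qed.

Lemma coord_prod_summable v : exists l : K, isum (coord_prod low v) l.
Proof.
pose B := 1 + \sum_l lnorm (v l).
have s0 : 0 <= \sum_l lnorm (v l) by apply: sumr_ge0 => l _; exact: lnorm_ge0.
have B0 : 0 < B by rewrite /B; lra.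
have vB l : lnorm (v l) <= B.
  rewrite /B (bigD1 l)//= addrCA lerDl addr_ge0// sumr_ge0// => j _.
  exact: lnorm_ge0.
have Bi : modulus (ofR F B^-1) = B^-1 by rewrite ge0_modulus_ofR// invr_ge0 ltW.
have [|l hl] := @isum_exists _ _ (coord_prod low (fun l => ofR F B^-1 *: v l)) (N%:R * S).
  apply: coord_prod_bounded => l.
  by rewrite lnormZ Bi ler_pdivrMl// mulr1.
exists (ofR F (B ^+ M) * l + 0).
have -> : coord_prod low v = fun i => ofR F (B ^+ M) *
    coord_prod low (fun l => ofR F B^-1 *: v l) i + 0.
  apply/funext => i; rewrite addr0 /coord_prod.
  under [in RHS]eq_bigr do rewrite dstarZ.
  rewrite big_split/= prodr_const card_low -ofRX mulrA -ofRM -exprMn.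
  by rewrite divff ?gt_eqF// expr1n ofR1 mul1r.
apply: isum_lin => // e e0; exists 0%N => m _.
by rewrite big1// subr0 modulus0 ltW.
Qed.

(** By [coord_prod_summable] the limit exists, so the default 0 of [xget] is not taken. *)
Definition coord_sum v : K := xget 0 [set l | isum (coord_prod low v) l].

Lemma coord_sumP v : isum (coord_prod low v) (coord_sum v).
Proof. exact: xgetPex (coord_prod_summable v). Qed.

Definition lead v : K := coord_prod (predC low) v 0%N.

(** Not symmetric: the first [M] slots carry the sum over coordinates, the others the coordinate of
    index 0. On the diagonal it is the polynomial P of the overview. *)
Definition extremal_form (v : {ptws 'I_N -> X}) : K := lead v * coord_sum v.

Lemma extremal_multilinear : multilinear_form extremal_form.
Proof.
move=> v k c x y; rewrite /extremal_form.
have [lk|lk] := boolP (low k).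
  have leadE z : lead (dfwith v k z) = lead v.
    by rewrite /lead coord_prod_dfwith /= lk.
  rewrite !leadE [X in _ * X = _](_ : _ =
    c * coord_sum (dfwith v k x) + coord_sum (dfwith v k y)).
    by rewrite mulrDr mulrCA.
  apply: isum_unique (coord_sumP _) _.
  rewrite (_ : coord_prod _ _ = fun i => c * coord_prod low (dfwith v k x) i +
    coord_prod low (dfwith v k y) i); last first.
    by apply/funext => i; exact: coord_prod_lin.
  by apply: isum_lin; exact: coord_sumP.
have sumE z : coord_sum (dfwith v k z) = coord_sum v.
  rewrite /coord_sum (_ : coord_prod low _ = coord_prod low v)//.
  by apply/funext => i; rewrite coord_prod_dfwith (negbTE lk).
by rewrite !sumE /lead coord_prod_lin//= mulrDl mulrA.
Qed.

Lemma lead_le1 v : (forall l, lnorm (v l) <= 1) -> modulus (lead v) <= 1.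
Proof.
move=> v1; rewrite modulus_prod; apply: prodr_ile1 => l _; rewrite modulus_ge0/=.
exact: le_trans (modulus_coord_le _ _) (v1 l).
Qed.

Lemma coord_sum_le v : (forall l, lnorm (v l) <= 1) ->
  modulus (coord_sum v) <= N%:R * S.
Proof. by move=> v1; apply: isum_le (coord_sumP v); exact: coord_prod_bounded. Qed.

Lemma extremal_continuous : continuous extremal_form.
Proof.
apply: (@bounded_continuous _ _ _ _ _ _ (1 * (N%:R * S)) extremal_multilinear) => v v1.
by rewrite modulusM ler_pM ?modulus_ge0 ?lead_le1 ?coord_sum_le.
Qed.

Lemma coord_sum_dunit v n : (forall l, low l -> v l = e_ n) -> coord_sum v = 1.
Proof.
move=> vn; apply: (isum_unique (coord_sumP v)).
have cpE i : coord_prod low v i = (i == n)%:R ^+ M.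
  rewrite /coord_prod -card_low -prodr_const; apply: eq_bigr => l /vn ->.
  by rewrite dunitE.
have -> : 1 = coord_prod low v n by rewrite cpE eqxx expr1n.
by apply: isum_single => i /negbTE ni; rewrite cpE ni expr0n; case: (M) M0.
Qed.

Lemma extremal_dunit0 : extremal_form (fun=> e_ 0) = 1.
Proof.
by rewrite /extremal_form (@coord_sum_dunit _ 0)// mulr1 /lead /coord_prod big1.
Qed.

(** Any set of [M] slots other than the first [M] puts [e_ n] into a slot where the coordinate 0 is
    read, which vanishes as [n > 0]. *)
Lemma extremal_coef x n : (0 < n)%N ->
  \sum_(T : {set 'I_N} | #|T| == M)
    extremal_form (fun k => if k \in T then e_ n else x) = lead (fun=> x).
Proof.
move=> n0; pose T0 : {set 'I_N} := [set l | low l]%SET.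
have T0M : #|T0| = M by rewrite cardsE card_low.
rewrite (bigD1 T0) ?T0M//= big1 ?addr0 => [|T /andP[/eqP TM TT0]].
  rewrite /extremal_form (@coord_sum_dunit _ n) ?mulr1.
    by apply: eq_bigr => l /= /negbTE ll; rewrite finset.in_set ll.
  by move=> l ll; rewrite finset.in_set ll.
have [l lT ll] : exists2 l, l \in T & ~~ low l.
  apply: contrapT => h; move/negP: TT0; apply; rewrite eqEcard TM T0M leqnn andbT.
  apply/fintype.subsetP => l lT; rewrite finset.in_set.
  by apply: contrapT => /negP ll; apply: h; exists l.
rewrite /extremal_form /lead /coord_prod (bigD1 l)//= lT dunitE.
by rewrite ltn_eqF// !mul0r.
Qed.

(** Over the reals with [M] even, [coord_sum] on the diagonal is a sum of squares. *)
Lemma extremal_same_sign x : ~~ odd M -> extremal_form (fun=> x) != 0 ->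
  same_sign (extremal_form (fun=> x)) (lead (fun=> x)).
Proof.
move=> oM; rewrite /extremal_form.
have sq i : exists y : K, coord_prod low (fun=> x) i = y ^+ 2.
  exists (x i ^+ M./2); rewrite /coord_prod prodr_const card_low -exprM muln2.
  by rewrite even_halfK.
move: (coord_sumP (fun=> x)) sq; move: (lead _) (coord_sum _) (coord_prod _ _).
rewrite /same_sign /isum; case: F => //= a b f fb sq ab.
have b0 : 0 <= b.
  rewrite leNgt; apply/negP => b0; have e0 : 0 < - b / 2 by lra.
  have [n /(_ n (leqnn n))] := fb _ e0; rewrite ler_norml => /andP[_].
  have : 0 <= \sum_(i < n) f i.
    by apply: sumr_ge0 => i _; have [y ->] := sq i; rewrite sqr_ge0.
  lra.
have a0 : a != 0 by apply: contraNneq ab => ->; rewrite mul0r.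
have b1 : b != 0 by apply: contraNneq ab => ->; rewrite mulr0.
by rewrite mulrAC -expr2 mulr_gt0 ?exprn_even_gt0// lt_neqAle eq_sym b1.
Qed.

End ExtremalForm.

(** * Failure of density *)

Section Coefficients.
Variables (R : realType) (F : scalar_kind) (w : nat -> R) (hw : admissible w).
Local Notation K := (Kfield R F).
Local Notation X := (dstar F hw).
Local Notation e_ := (dunit F hw).

Section Form.
Variables (d : nat) (Phi : {ptws 'I_d -> X} -> K) (x0 : X).
Hypotheses (hPhi : multilinear_form Phi) (cPhi : continuous Phi).

(* The coefficient of [l ^ j] in the expansion of [Phi] at [x0 + l e_n]. *)
Definition form_coef (j n : nat) : K :=
  \sum_(T : {set 'I_d} | #|T| == j) Phi (fun k => if k \in T then e_ n else x0).

(** The sum runs to [N] rather than [d], so that expansions of components of different degrees can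
    be added; for [j > d] the coefficient is an empty sum. *)
Lemma form_coef_expand (N n : nat) (l : K) : (d <= N)%N ->
  Phi (fun=> x0 + l *: e_ n) = \sum_(j < N.+1) l ^+ j * form_coef j n.
Proof.
move=> dN; rewrite (ml_expand hPhi (fun=> x0) (fun=> l *: e_ n)).
rewrite (partition_big (fun T : {set 'I_d} => inord #|T| : 'I_N.+1) xpredT)//=.
apply: eq_bigr => j _; rewrite /form_coef mulr_sumr.
have TN (T : {set 'I_d}) : (#|T| < N.+1)%N.
  by rewrite ltnS (leq_trans _ dN)// -[leqRHS]card_ord max_card.
apply: eq_big => [T|T /eqP <-].
  by rewrite -val_eqE/= inordK.
have -> : (fun k => if k \in T then l *: e_ n else x0) =
    (fun k => (if k \in T then l else 1) *: (if k \in T then e_ n else x0)).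
  by apply/funext => k; case: ifP; rewrite ?scale1r.
by rewrite ml_scale// -big_mkcond/= prodr_const inordK.
Qed.

Lemma form_coef_bounded : lnorm x0 <= 1 ->
  exists C, forall j n, modulus (form_coef j n) <= C.
Proof.
move=> x01; have [C C0 hC] := multilinear_bounded hPhi cPhi.
exists (\sum_(T : {set 'I_d}) C) => j n.
apply: le_trans (ler_modulus_sum _ _ _) _; rewrite big_mkcond/=.
apply: ler_sum => T _; case: ifP => _; last exact: ltW.
by apply: hC => k; case: ifP => // _; exact: lnorm_dunit.
Qed.

(** In each term the slots of [T] hold far unit vectors and the others are frozen at [x0]:
    [null_base] applies with exactly [j] live slots. *)
Lemma form_coef_null j : (0 < j)%N -> power_divergent w j ->
  forall e : R, 0 < e ->
  exists m, forall n, (m <= n)%N -> modulus (form_coef j n) <= e.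
Proof.
move=> j0 pj e e0; pose D : R := #|{set 'I_d}|.+1%:R.
have eD0 : 0 < e / D by rewrite divr_gt0// ltr0n.
have /choice[f hf] : forall T : {set 'I_d}, exists m, #|T| = j ->
    forall n, (m <= n)%N ->
    modulus (Phi (fun k => if k \in T then e_ n else x0)) <= e / D.
  move=> T; have [Tj|Tj] := eqVneq #|T| j; last first.
    by exists 0%N => /eqP; rewrite (negbTE Tj).
  pose s k := if k \in T then Unit else Fixed.
  have liveT : [set k | ~~ is_fixed (s k)]%SET = T.
    by apply/setP => k; rewrite finset.in_set /s; case: ifP.
  have s0 k : slot_weight (s k) = 0%N by rewrite /s; case: ifP.
  have := null_base (fun=> x0) hPhi cPhi s0.
  rewrite /= liveT Tj => /(_ j0 pj _ eD0)[m hm].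
  exists m => _ n mn; apply: hm => k; rewrite /s.
  by case: ifP => // _; exists n.
exists (\max_T f T) => n mn; apply: le_trans (ler_modulus_sum _ _ _) _.
apply: (@le_trans _ _ (\sum_(T : {set 'I_d}) e / D)).
  rewrite big_mkcond/=; apply: ler_sum => T _; case: ifP => [/eqP Tj|_].
    by apply: hf => //; apply: leq_trans mn; exact: leq_bigmax.
  exact: ltW.
rewrite sumr_const -[leLHS]mulr_natl mulrA ler_pdivrMr ?ltr0n//.
by rewrite mulrC ler_pM2l// ler_nat.
Qed.

End Form.

Lemma homogeneousZ d (P : X -> K) (t : K) x : homogeneous_polynomials d P ->
  P (t *: x) = t ^+ d * P x.
Proof.
move=> [Phi [hPhi _ ->]]; rewrite (ml_scale hPhi (fun=> t) (fun=> x)).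
by rewrite prodr_const card_ord.
Qed.

Lemma homogeneous_coefs (N d : nat) (P : X -> K) (x0 : X) : (d <= N)%N ->
  lnorm x0 <= 1 -> homogeneous_polynomials d P -> exists b : nat -> nat -> K,
  [/\ forall n (l : K), P (x0 + l *: e_ n) = \sum_(j < N.+1) l ^+ j * b j n,
      exists C, forall j n, modulus (b j n) <= C &
      forall j, (0 < j)%N -> power_divergent w j -> forall e : R, 0 < e ->
        exists m, forall n, (m <= n)%N -> modulus (b j n) <= e].
Proof.
move=> dN x01 [Phi [hPhi cPhi ->]]; exists (form_coef Phi x0); split.
- by move=> n l; exact: form_coef_expand.
- exact: form_coef_bounded.
- exact: form_coef_null.
Qed.

End Coefficients.

(** * Excluding a local maximum along far unit vectors *)

Section Peak.
Variables (R : realType) (F : scalar_kind).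
Local Notation K := (Kfield R F).

(* The lower coefficients vanish in the limit and the higher ones are negligible
   for small [l], so [c M n] dictates the growth in a well-chosen direction. *)
Lemma no_peak (N M n0 : nat) (c : nat -> nat -> K) (q : K) (eta C d : R) :
  (0 < M)%N -> (M <= N)%N -> 0 < eta -> 0 < d -> q != 0 ->
  (forall n (l : K), (n0 <= n)%N -> modulus l <= d ->
    modulus (\sum_(j < N.+1) l ^+ j * c j n) <= modulus q) ->
  (forall n, c 0%N n = q) ->
  (forall j n, modulus (c j n) <= C) ->
  (forall j, (0 < j < M)%N -> forall e : R, 0 < e ->
    exists m, forall n, (m <= n)%N -> modulus (c j n) <= e) ->
  (forall n, (n0 <= n)%N -> eta <= modulus (c M n) /\
    (~~ odd M -> same_sign (c M n) q)) -> False.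
Proof.
move=> M0 MN eta0 d0 q0 peak cq cC cnull cM.
have C0 : 0 <= C by apply: le_trans (modulus_ge0 (c 0 0)%N) (cC _ _).
(* Each remaining term is to be at most [k = eta * t ^+ M / D], so that together they cancel at most
   half of the gain. A small [t] ensures this for degrees above [M], a large [n] for degrees
   below. *)
pose D : R := 2 * N.+1%:R.
have D0 : 0 < D by rewrite mulr_gt0// ltr0n.
have C1 : 0 < D * (C + 1) by rewrite mulr_gt0// ltr_wpDl.
pose t := Num.min d (Num.min 1 (eta / (D * (C + 1)))).
have t0 : 0 < t by rewrite !lt_min d0 ltr01 divr_gt0.
have td : t <= d by rewrite ge_min lexx.
have t1 : t <= 1 by rewrite !ge_min lexx orbT.
have tC : C * t <= eta / D.
  have : t <= eta / (D * (C + 1)) by rewrite !ge_min lexx !orbT.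
  rewrite !ler_pdivlMr//; apply: le_trans.
  by have := mulr_gt0 t0 D0; lra.
pose k := eta * t ^+ M / D.
have tM0 : 0 < t ^+ M by rewrite exprn_gt0.
have k0 : 0 < k by rewrite divr_gt0// mulr_gt0.
have /choice[m hm] : forall j : 'I_N.+1, exists m, (0 < j < M)%N ->
    forall n, (m <= n)%N -> modulus (c j n) <= k.
  move=> j; have [jM|jM] := boolP (0 < j < M)%N; last by exists 0%N.
  by have [m hm] := cnull j jM k k0; exists m.
pose n := maxn n0 (\max_j m j).
have n0n : (n0 <= n)%N by exact: leq_maxl.
have [cMeta cMq] := cM n n0n.
have cM0 : c M n != 0.
  by apply: contraTneq cMeta => ->; rewrite modulus0 -ltNge.
have [u u1 hu] := aligned_direction M0 cM0 q0 cMq.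
have mt : modulus (ofR F t) = t by rewrite ge0_modulus_ofR// ltW.
have := peak n (u * ofR F t) n0n; rewrite modulusM u1 mul1r mt => /(_ td).
have MN1 : (M < N.+1)%N by [].
have M0' : Ordinal MN1 != ord0 :> 'I_N.+1 by rewrite -val_eqE/= -lt0n.
rewrite (bigD1 ord0)// (bigD1 (Ordinal MN1))//= expr0 mul1r cq addrA.
set rest := \sum_(i < N.+1 | _) _.
have -> : (u * ofR F t) ^+ M * c M n = c M n * u ^+ M * ofR F (t ^+ M).
  by rewrite exprMn mulrC ofRX mulrA.
have hrest : modulus rest <= eta * t ^+ M / 2.
  apply: le_trans (ler_modulus_sum _ _ _) _.
  apply: (@le_trans _ _ (\sum_(i < N.+1) k)); last first.
    rewrite sumr_const card_ord -[leLHS]mulr_natl /k /D.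
    by rewrite le_eqVlt; apply/orP; left; apply/eqP; field.
  rewrite big_mkcond/=; apply: ler_sum => j _; case: ifP => [|_]; last exact: ltW.
  move=> /andP[j0 jM]; rewrite modulusM modulusX modulusM u1 mul1r mt.
  rewrite -val_eqE/= in j0; rewrite -val_eqE/= in jM.
  have [jltM|Mltj|/eqP] := ltngtP j M; last by rewrite (negbTE jM).
    apply: le_trans (_ : modulus (c j n) <= k).
      by rewrite ler_piMl ?modulus_ge0// exprn_ile1// ltW.
    apply: hm; first by rewrite lt0n j0.
    by rewrite leq_max (leq_bigmax j) orbT.
  apply: (@le_trans _ _ (t ^+ M.+1 * C)).
    apply: ler_pM; rewrite ?modulus_ge0 ?exprn_ge0 ?(ltW t0)//.
    by apply: ler_wiXn2l; rewrite ?(ltW t0).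
  have -> : k = t ^+ M * (eta / D) by rewrite /k mulrAC mulrC.
  by rewrite exprSr -mulrA [t * C]mulrC ler_pM2l.
have := hu (t ^+ M) (ltW tM0) => hup hpeak.
have : modulus (q + c M n * u ^+ M * ofR F (t ^+ M)) <= modulus q + modulus rest.
  set z := q + _ in hpeak *; rewrite -[z](addrK rest).
  by apply: le_trans (ler_modulusB _ _) _; rewrite lerD2r.
rewrite hup lerD2l => /le_trans/(_ hrest).
have : eta * t ^+ M <= modulus (c M n) * t ^+ M by rewrite ler_pM2r.
have : 0 < eta * t ^+ M by rewrite mulr_gt0.
lra.
Qed.

End Peak.

Section NotDense.
Variables (R : realType) (F : scalar_kind) (w : nat -> R) (hw : admissible w).
Local Notation K := (Kfield R F).
Local Notation X := (dstar F hw).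
Local Notation e_ := (dunit F hw).

(** Shows that the least exponent [M] at which divergence fails is positive. *)
Lemma power_divergent0 : power_divergent w 0.
Proof.
move=> T; exists (Num.bound `|T|); under eq_bigr do rewrite expr0.
rewrite sumr_const card_ord.
exact: le_lt_trans (ler_norm _) (archi_boundP _).
Qed.

Lemma polynomials_bounded k (Q : X -> K) : polynomials k Q ->
  exists C, forall x, lnorm x <= 1 -> modulus (Q x) <= C.
Proof.
move=> [q [hq ->]].
have /choice[C hC] := fun j => homogeneous_bounded (hq j).
exists (\sum_j C j) => x x1; apply: le_trans (ler_modulus_sum _ _ _) _.
by apply: ler_sum => j _; exact: hC.
Qed.

Theorem not_approximable N : ~ power_divergent w N ->
  exists2 P : X -> K, homogeneous_polynomials N P &
  ~ approximable_by (norm_attaining (V := X) `&` polynomials N) P.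
Proof.
move=> npN.
have exM : exists M, ~~ `[< power_divergent w M >] by exists N; apply/asboolPn.
have [M /asboolPn npM Mmin] := ex_minnP exM.
have MN : (M <= N)%N by apply: Mmin; apply/asboolPn.
have M0 : (0 < M)%N.
  by rewrite lt0n; apply/eqP => h; apply: npM; rewrite h; exact: power_divergent0.
have pj j : (j < M)%N -> power_divergent w j.
  by move=> jM; apply: contrapT => /asboolPn/Mmin; rewrite leqNgt jM.
have [S wS] : exists S, forall m, \sum_(i < m) w i ^+ M <= S.
  have [S hS] := (existsNP _).2 npM; exists S => m.
  by rewrite leNgt; apply/negP => h; apply: hS; exists m.
pose Phi := @extremal_form R F w hw N M.
have hPhi : multilinear_form Phi := extremal_multilinear M0 MN wS.
have cPhi : continuous Phi := extremal_continuous M0 MN wS.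
pose P (x : X) := Phi (fun=> x).
have hP : homogeneous_polynomials N P by exists Phi.
exists P => // app.
have [C C0 hcoef] := @poly_coef_le R F N.
pose B := N%:R * S.
have S1 : 1 <= S.
  by have := wS 1%N; rewrite big_ord1 (admissible_first hw) expr1n.
have N0 : (0 < N)%N by exact: leq_trans MN.
have B1 : 1 <= B by rewrite /B -[leLHS]mulr1 ler_pM ?ler1n.
have B0 : 0 < B by exact: lt_le_trans B1.
pose A := N.+1%:R * (C * C).
have A0 : 0 <= A by rewrite !mulr_ge0.
have A1 : 0 < A + 1 by rewrite ltr_wpDl.
have B40 : 0 < 4 * B by exact: mulr_gt0.
have B4 : 0 < (4 * B)^-1 by rewrite invr_gt0.
(* [A * eps] will bound the error in the coefficient of [l ^+ M]; it is kept below half of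
   [(2 * B)^-1], a lower bound for the modulus of [g]. Also [eps <= 1/4], so that [P x0] has modulus
   at least 1/2. *)
pose eps := (A + 1)^-1 * (4 * B)^-1.
have eps0 : 0 < eps by rewrite mulr_gt0// invr_gt0.
have Aeps : A * eps <= (4 * B)^-1.
  rewrite /eps mulrA ler_piMl ?(ltW B4)//.
  by rewrite ler_pdivrMr// mul1r lerDl.
have eps4 : eps <= 4^-1.
  rewrite /eps -[leRHS]mul1r; apply: ler_pM; rewrite ?invr_ge0 ?(ltW A1)//.
  - exact: ltW.
  - by rewrite invf_le1// lerDr.
  - by rewrite lef_pV2 ?posrE// ler_peMr.
have [Q [[x0 /closed_unit_ballE x01 Qx0] pQ] PQ] := app eps eps0.
have [CQ hCQ] := polynomials_bounded pQ.
have [CP hCP] := homogeneous_bounded hP.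
have PQeps x : lnorm x <= 1 -> modulus (P x - Q x) <= eps.
  move=> x1; apply: le_trans (ltW PQ).
  apply: (@le_poly_norm _ _ _ _ (P - Q) (CP + CQ)) => // y y1.
  by apply: le_trans (ler_modulusB _ _) _; rewrite lerD ?hCP ?hCQ.
have Qmax x : lnorm x <= 1 -> modulus (Q x) <= modulus (Q x0).
  by move=> x1; rewrite Qx0; exact: le_poly_norm hCQ x1.
have P1 : P (e_ 0) = 1 := extremal_dunit0 F hw M0 MN wS.
have Qx0_ge : 1 - eps <= modulus (Q x0).
  apply: le_trans (Qmax _ (lnorm_dunit F hw 0)).
  have := PQeps _ (lnorm_dunit F hw 0); rewrite P1.
  have := ler_dist_modulus (1 : K) (Q (e_ 0)); rewrite modulus1 ler_norml.
  by move=> /andP[_]; lra.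
have Px0_ge : 2^-1 <= modulus (P x0).
  have := ler_dist_modulus (P x0) (Q x0); rewrite ler_norml => /andP[+ _].
  by have := PQeps _ x01; lra.
have Px0 : P x0 != 0 by apply: contraTneq Px0_ge => ->; rewrite modulus0 -ltNge.
have Qx0' : Q x0 != 0.
  by apply: contraTneq Qx0_ge => ->; rewrite modulus0 -ltNge; lra.
pose g := @lead R F w hw N M (fun=> x0).
have g_ge : (2 * B)^-1 <= modulus g.
  have : modulus (P x0) <= modulus g * B.
    rewrite /P /Phi /extremal_form modulusM ler_wpM2l ?modulus_ge0//.
    exact: (coord_sum_le M0 MN wS).
  by move=> h; rewrite invfM ler_pdivrMr// (le_trans Px0_ge).
have [q [hq QE]] := pQ.
have /choice[b hb] : forall j : 'I_N.+1, _ :=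
  fun j => homogeneous_coefs (ltn_ord j : (j <= N)%N) x01 (hq j).
have [n0 [d d0 ball]] := perturb_in_ball x01.
pose bP := form_coef Phi x0.
(* The coefficient of [l ^+ i] in the component of degree [j] of [Q - P]; [P] contributes only in
   degree [N], the index [ord_max]. *)
pose D (j : 'I_N.+1) i n := b j i n - (if j == ord_max then bP i n else 0).
(* Two uses of [poly_coef_le], each costing a factor [C]: in [t] to isolate the homogeneous
   components at [y], in [l] to isolate the coefficients of each. *)
have Dle (j : 'I_N.+1) i n : (i <= N)%N -> modulus (D j i n) <= C * (C * eps).
  move=> iN; apply: (hcoef (fun i => D j i n)) => // [|l /andP[l0 l1]].
    by rewrite mulr_ge0// ltW.
  pose y := x0 + ofR F l *: e_ n.
  pose E (j : 'I_N.+1) := \sum_(i < N.+1) ofR F l ^+ i * D j i n.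
  have EE j' : E j' = q j' y - (if j' == ord_max then P y else 0).
    have [-> _ _] := hb j'; rewrite /E.
    under eq_bigr do rewrite mulrBr.
    rewrite sumrB; congr (_ - _); case: ifP => _; last first.
      by rewrite big1// => i' _; rewrite mulr0.
    by rewrite /P /y (form_coef_expand x0 hPhi n _ (leqnn N)).
  pose E' i := E (inord i).
  have -> : \sum_(i' < N.+1) ofR F l ^+ i' * D j i' n = E' j.
    by rewrite /E' inord_val.
  apply: hcoef => //; [exact: ltW| |by rewrite -ltnS].
  move=> t /andP[t0 t1].
  have -> : \sum_(i < N.+1) ofR F t ^+ i * E' i =
      Q (ofR F t *: y) - P (ofR F t *: y).
    rewrite QE (homogeneousZ _ _ hP).
    rewrite (eq_bigr (fun i : 'I_N.+1 => ofR F t ^+ i * q i y -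
      (if i == ord_max then ofR F t ^+ N * P y else 0))); last first.
      move=> i' _; rewrite /E' inord_val EE mulrBr; congr (_ - _).
      by case: eqP => [->//|_]; rewrite mulr0.
    rewrite sumrB -big_mkcond/= big_pred1_eq; congr (_ - _).
    by apply: eq_bigr => i' _; rewrite (homogeneousZ _ _ (hq i')).
  rewrite modulusB; apply: PQeps.
  (* This is why [poly_coef_le] works on [[0, 1/2]]: [y] has norm at most 3/2, and [t <= 1/2] brings
     it back into the ball. *)
  rewrite lnormZ ge0_modulus_ofR//.
  have y2 : lnorm y <= 1 + l.
    apply: le_trans (lnormD _ _) _; rewrite lerD// lnormZ ge0_modulus_ofR//.
    by rewrite ler_piMr// lnorm_dunit.
  have := lnorm_ge0 y; nra.
pose c i n := \sum_(j < N.+1) b j i n.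
have QcE n l : Q (x0 + l *: e_ n) = \sum_(i < N.+1) l ^+ i * c i n.
  rewrite QE /c; under [RHS]eq_bigr do rewrite mulr_sumr.
  rewrite exchange_big/=; apply: eq_bigr => j _.
  by have [-> _ _] := hb j.
have cMg n : (0 < n)%N -> modulus (c M n - g) <= A * eps.
  move=> n_gt0; have -> : c M n - g = \sum_(j < N.+1) D j M n.
    rewrite sumrB -big_mkcond/= big_pred1_eq; congr (_ - _).
    by rewrite /bP /form_coef (extremal_coef M0 MN wS).
  apply: le_trans (ler_modulus_sum _ _ _) _.
  apply: (@le_trans _ _ (\sum_(j < N.+1) C * (C * eps))).
    by apply: ler_sum => j _; exact: Dle.
  by rewrite sumr_const card_ord -[leLHS]mulr_natl /A !mulrA.
have gB : (2 * B)^-1 = (4 * B)^-1 + (4 * B)^-1.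
  by field; rewrite gt_eqF.
have /choice[Cb hCb] : forall j : 'I_N.+1, exists C, forall i n, modulus (b j i n) <= C.
  by move=> j; have [] := hb j.
apply: (@no_peak R F N M (maxn n0 1) c (Q x0) (4 * B)^-1 (\sum_j Cb j) d) => //.
- move=> n l nn ld; have <- := QcE n l; apply/Qmax/ball => //.
  exact: leq_trans (leq_maxl _ _) nn.
- move=> n; have := QcE n 0; rewrite scale0r addr0 => ->.
  rewrite big_ord_recl expr0 mul1r big1 ?addr0// => i _.
  by rewrite expr0n mul0r.
- move=> j n; apply: le_trans (ler_modulus_sum _ _ _) _.
  by apply: ler_sum => i _; exact: hCb.
- move=> i /andP[i0 iM] e e0.
  have eN0 : 0 < e / N.+1%:R by rewrite divr_gt0.
  have /choice[m hm] : forall j : 'I_N.+1, exists m, forall n, (m <= n)%N ->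
      modulus (b j i n) <= e / N.+1%:R.
    by move=> j; have [_ _] := hb j; apply => //; exact: pj.
  exists (\max_j m j) => n mn; apply: le_trans (ler_modulus_sum _ _ _) _.
  apply: (@le_trans _ _ (\sum_(j < N.+1) e / N.+1%:R)).
    by apply: ler_sum => j _; apply: hm; apply: leq_trans mn; exact: leq_bigmax.
  by rewrite sumr_const card_ord -[leLHS]mulr_natl mulrC divfK// pnatr_eq0.
move=> n nn; have n_gt0 : (0 < n)%N by exact: leq_trans (leq_maxr _ _) nn.
have cg := cMg n n_gt0; split.
  have := ler_dist_modulus (c M n) g; rewrite ler_norml => /andP[+ _].
  by move: cg Aeps g_ge; rewrite gB; lra.
(* Chain of signs: [c M n] is close to [g], [g] has the sign of [P x0], and [P x0] is close to
   [Q x0]. *)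
move=> oM; apply: (@same_sign_trans _ _ _ g).
  by apply: same_sign_near; apply: le_lt_trans cg _; move: Aeps g_ge; rewrite gB; lra.
apply: (@same_sign_trans _ _ _ (P x0)).
  by apply: same_sign_sym; exact: (extremal_same_sign M0 MN wS).
by apply: same_sign_near; apply: le_lt_trans (PQeps _ x01) _; lra.
Qed.

End NotDense.

(** * The equivalence *)

Lemma homogeneous_polynomials0 (R : realType) (F : scalar_kind)
  (V : normedModType (Kfield R F)) n : homogeneous_polynomials n (0 : V -> Kfield R F).
Proof.
exists (fun=> 0); split=> //; last exact: cst_continuous.
by move=> v i k a b /=; rewrite mulr0 addr0.
Qed.

Lemma homogeneous_polynomials_sub (R : realType) (F : scalar_kind)
  (V : normedModType (Kfield R F)) n k (P : V -> Kfield R F) : (n <= k)%N ->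
  homogeneous_polynomials n P -> polynomials k P.
Proof.
move=> nk hP; have nk1 : (n < k.+1)%N by [].
exists (fun j : 'I_k.+1 => if j == Ordinal nk1 then P else 0); split.
  move=> j; case: eqP => [->//|_]; exact: homogeneous_polynomials0.
apply/funext => x; rewrite (bigD1 (Ordinal nk1))//= eqxx big1 ?addr0// => j.
by move=> /negbTE ->.
Qed.

Theorem proposition4p3 (R : realType) (F : scalar_kind) (w : nat -> R)
    (hw : admissible w) (N : nat) (hN : (2 <= N)%N) :
  let X := dstar F hw in
  [<-> dense_in (norm_attaining (V := X) `&` homogeneous_polynomials N)
         (homogeneous_polynomials N);
       forall k : nat, (N <= k)%N ->
         forall P : X -> Kfield R F, homogeneous_polynomials N P ->
           approximable_by (norm_attaining (V := X) `&` polynomials k) P;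
       ~ summable [set: nat] (fun i => (w i ^+ N)%:E)].
Proof.
move=> X; tfae.
- move=> [_ dense] k Nk P /dense app e /app[Q [naQ hQ] PQ]; exists Q => //.
  by split=> //; exact: homogeneous_polynomials_sub Nk hQ.
- move=> app; apply/power_divergentP => //; apply: contrapT => npN.
  (* The second statement is taken at [k = N]. *)
  have [P hP] := not_approximable F hw npN; apply; exact: app hP.
- by move=> /(power_divergentP hw); exact: norm_attaining_dense.
Qed.
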